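(* Let $U\in\mathcal{U}(n)$ and let $X\in\mathcal{H}(n)$ be such that $U=e^{iX}$ and $\|X\|_\infty\le\pi$. (a) Suppose $\sigma(|X|)\subseteq[0,\pi)$ and $\sigma(|X|)$ has more than one element. Let $\mathcal{S}=\ker(\|X\|_\infty I-|X|)$ and $X_{\mathcal S}=X|_{\mathcal S}\in\mathcal{H}(\mathcal S)$. Then the minimal curves joining $I$ with $U$ are precisely the curves $\alpha:[0,1]\to\mathcal{U}(n)$ of the form $$\alpha(t)=\begin{pmatrix} e^{itX_{\mathcal S}}&0\\0&\alpha_1(t)\end{pmatrix}$$ with respect to $\mathbb{C}^n=\mathcal S\oplus\mathcal S^\perp$, where $\alpha_1:[0,1]\to\mathcal{U}(\mathcal S^\perp)$ is any curve joining $I_{\mathcal S^\perp}$ with $U_{\mathcal S^\perp}=U|_{\mathcal S^\perp}$ such that $\|\dot\alpha_1\|_\infty\le\|X\|_\infty$. (b) Suppose $\pi\in\sigma(|X|)$. Let $\mathcal S=\ker(\pi I-|X|)$. Then the minimal curves joining $I$ with $U$ are precisely the curves $\alpha:[0,1]\to\mathcal{U}(n)$ of the form $$\alpha(t)=\begin{pmatrix} e^{itY_{\mathcal S}}&0\\0&\alpha_1(t)\end{pmatrix}$$ with respect to $\mathbb{C}^n=\mathcal S\oplus\mathcal S^\perp$, where $Y_{\mathcal S}\in\mathcal{H}(\mathcal S)$ satisfies $\sigma(Y_{\mathcal S})\subseteq\{\pi,-\pi\}$, and $\alpha_1:[0,1]\to\mathcal{U}(\mathcal S^\perp)$ is any curve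 joining $I_{\mathcal S^\perp}$ with $U_{\mathcal S^\perp}=U|_{\mathcal S^\perp}$ such that $\|\dot\alpha_1\|_\infty\le\pi$.
   Context: $\mathcal{U}(n)$ is the group of $n\times n$ complex unitary matrices and $\mathcal{H}(n)$ the real vector space of $n\times n$ Hermitian matrices; for a subspace $\mathcal S\subseteq\mathbb{C}^n$, $\mathcal{U}(\mathcal S)$ and $\mathcal{H}(\mathcal S)$ are the unitary, respectively Hermitian, operators on $\mathcal S$. $\|\cdot\|_\infty$ is the spectral (operator) norm, $|X|=(X^*X)^{1/2}$, and $\sigma(\cdot)$ is the set of eigenvalues. The length of a (piecewise smooth) curve $\alpha:[0,1]\to\mathcal{U}(n)$ is $L(\alpha)=\int_0^1\|\dot\alpha(t)\|_\infty\,dt$, and $d_\infty(U,V)$ is the infimum of the lengths of piecewise smooth curves in $\mathcal{U}(n)$ joining $U$ with $V$. A curve joining $U$ with $V$ is minimal if its length equals $d_\infty(U,V)$. Convention: minimal curves are parametrized by $[0,1]$ so that $t\mapsto\|\dot\alpha(t)\|_\infty$ is constant. *)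

(* Defs.v *)
From HB Require Import structures.
From mathcomp Require Import all_boot all_order all_algebra.
From mathcomp Require Import sesquilinear spectral.
From mathcomp Require Import all_classical all_reals all_analysis.
From mathcomp.real_closed Require Import complex.

Set Implicit Arguments.
Unset Strict Implicit.
Unset Printing Implicit Defensive.

Import Order.TTheory GRing.Theory Num.Theory.
Import numFieldNormedType.Exports.

Local Open Scope classical_set_scope.
Local Open Scope ring_scope.
Local Open Scope complex_scope.
Local Open Scope sesquilinear_scope.

Section MatrixAnalysis.
Context {R : realType}.
Local Notation C := R[i].
(* Re and Im alone denote the C-valued Num.Re and Num.Im. *)
Local Notation re := (@complex.Re R).
Local Notation im := (@complex.Im R).

Definition l2norm n (v : 'cV[C]_n) : R :=
  Num.sqrt (\sum_i (Normc.normc (v i 0)) ^+ 2).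

(* The supremum is over the closed unit ball rather than the unit sphere, so
   that it is 0 (and not the supremum of the empty set) when n = 0. *)
Definition opnorm m n (A : 'M[C]_(m, n)) : R :=
  sup [set l2norm (A *m v) | v in [set v : 'cV[C]_n | l2norm v <= 1]].

Definition psdmx n (A : 'M[C]_n) : Prop :=
  A \is hermsymmx /\ forall v : 'cV[C]_n, 0 <= (v^t* *m A *m v) 0 0.

(* The positive semidefinite square root of X^* X; see absmxP below. *)
Definition absmx n (X : 'M[C]_n) : 'M[C]_n :=
  xget 0 [set A | psdmx A /\ A *m A = X^t* *m X].

Definition spectrum n (A : 'M[C]_n) : set C := [set a | eigenvalue A a].

(* The sum of the exponential series, the limit being taken entrywise. *)
Definition expmx n (A : 'M[C]_n) : 'M[C]_n :=
  let S N := \sum_(k < N) (k`!%:R : C)^-1 *: A ^+ k in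
  \matrix_(j, k) (limn (fun N => re (S N j k)) +i* limn (fun N => im (S N j k))).

(* A curve [0, 1] -> M_n(C) is represented by a function on R of which only the
   values on [0, 1] are relevant. *)
Definition mxderivable n (g : R -> 'M[C]_n) (t : R) : Prop :=
  forall j k, derivable (fun s => re (g s j k)) t 1 /\
              derivable (fun s => im (g s j k)) t 1.

Definition mxderive n (g : R -> 'M[C]_n) (t : R) : 'M[C]_n :=
  \matrix_(j, k) ((fun s => re (g s j k))^`()%classic t +i*
                  (fun s => im (g s j k))^`()%classic t).

Definition speed n (g : R -> 'M[C]_n) (t : R) : R := opnorm (mxderive g t).

Definition smooth (f : R -> R) : Prop :=
  forall k x, derivable (f^`(k)%classic) x 1.

Definition mxsmooth n (g : R -> 'M[C]_n) : Prop :=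
  forall j k, smooth (fun s => re (g s j k)) /\ smooth (fun s => im (g s j k)).

(* On each closed piece the curve coincides with a C^infinity map on R; in
   particular it is continuous at the break points. *)
Definition piecewise_smooth n (g : R -> 'M[C]_n) : Prop :=
  exists2 s : seq R, itv_partition 0 1 s &
    forall i, (i < size s)%N ->
      exists2 h : R -> 'M[C]_n, mxsmooth h &
        {in `[nth 1 (0 :: s) i, nth 1 s i], g =1 h}.

Definition curve_joining n (U V : 'M[C]_n) (g : R -> 'M[C]_n) : Prop :=
  [/\ piecewise_smooth g,
      forall t, 0 <= t <= 1 -> g t \is unitarymx,
      g 0 = U & g 1 = V].

(* The speed takes a junk value where g is not derivable, and possibly at 0 and
   1, but for a piecewise smooth g this is a finite set of points. *)
Definition curve_length n (g : R -> 'M[C]_n) : R :=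
  Rintegral lebesgue_measure `[0, 1] (speed g).

Definition dinf n (U V : 'M[C]_n) : R :=
  inf [set curve_length g | g in [set g | curve_joining U V g]].

Definition constant_speed n (g : R -> 'M[C]_n) : Prop :=
  exists c : R, forall t, 0 < t < 1 -> mxderivable g t -> speed g t = c.

Definition speed_bounded n (g : R -> 'M[C]_n) (c : R) : Prop :=
  forall t, 0 < t < 1 -> mxderivable g t -> speed g t <= c.

Definition minimal_curve n (U V : 'M[C]_n) (g : R -> 'M[C]_n) : Prop :=
  [/\ curve_joining U V g, curve_length g = dinf U V & constant_speed g].

Definition kerset m n (A : 'M[C]_(m, n)) : set 'cV[C]_n :=
  [set v | A *m v = 0].

Definition orthocompl n (S : set 'cV[C]_n) : set 'cV[C]_n :=
  [set v | forall w, S w -> w^t* *m v = 0].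

(* The columns of B are an orthonormal basis of S. *)
Definition orthonormal_basis n p (B : 'M[C]_(n, p)) (S : set 'cV[C]_n) : Prop :=
  B^t* *m B = 1%:M /\ S = [set B *m w | w in [set: 'cV[C]_p]].

(* When the span of the orthonormal columns of B is invariant under A, the
   matrix in the basis B of the restriction of A to that span. *)
Definition restrict_op n p (B : 'M[C]_(n, p)) (A : 'M[C]_n) : 'M[C]_p :=
  B^t* *m A *m B.

(* The operator on C^n with block matrix diag(D, D') with respect to the
   decomposition of C^n given by the orthonormal bases B and B'. *)
Definition block_op n p q (B : 'M[C]_(n, p)) (B' : 'M[C]_(n, q))
    (D : 'M[C]_p) (D' : 'M[C]_q) : 'M[C]_n :=
  row_mx B B' *m block_mx D 0 0 D' *m (row_mx B B')^t*.

Lemma absmxP n (X : 'M[C]_n) :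
  psdmx (absmx X) /\ absmx X *m absmx X = X^t* *m X.
Proof.
have tCM m1 m2 m3 (A : 'M[C]_(m1, m2)) (B : 'M[C]_(m2, m3)) :
    (A *m B)^t* = B^t* *m A^t* by rewrite trmx_mul map_mxM.
have l2 m1 (v : 'cV[C]_m1) : 0 <= (v^t* *m v) 0 0.
  rewrite !mxE sumr_ge0// => j _; rewrite !mxE mulrC; exact: mul_conjC_ge0.
have hermE (A : 'M[C]_n) : A^t* = A -> A \is hermsymmx.
  by move=> h; apply/is_hermitianmxP; rewrite expr0 scale1r h.
pose M := X^t* *m X; pose P := spectralmx M; pose d := spectral_diag M.
have MH : M \is hermsymmx by apply: hermE; rewrite tCM trmxCK.
have Pu : P \is unitarymx := spectral_unitarymx M.
have PP : P *m P^t* = 1%:M by apply/unitarymxP.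
have ME : M = P^t* *m diag_mx d *m P.
  have /orthomx_spectralP := hermitian_normalmx MH.
  by rewrite invmx_unitary.
have dE i : d 0 i = ((X *m (row i P)^t*)^t* *m (X *m (row i P)^t*)) 0 0.
  have -> : (X *m (row i P)^t*)^t* *m (X *m (row i P)^t*)
          = row i P *m M *m (row i P)^t*.
    by rewrite tCM trmxCK /M !mulmxA.
  have rP : row i P *m P^t* = delta_mx 0 i.
    by rewrite -row_mul PP row1.
  have rP' : P *m (row i P)^t* = (delta_mx 0 i)^t*.
    by rewrite -rP tCM trmxCK.
  rewrite ME !mulmxA rP -mulmxA rP' -rowE.
  rewrite !mxE (bigD1 i)//= big1 ?addr0 => [|j /negPf ji].
    by rewrite !mxE !eqxx conjC1 mulr1.
  by rewrite !mxE eqxx ji conjC0 mulr0.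
have d0 i : 0 <= d 0 i by rewrite dE.
pose e := map_mx sqrtC d.
have eT : (diag_mx e)^t* = diag_mx e.
  apply/matrixP => i j; rewrite !mxE eq_sym; case: eqVneq => [->|_].
    by rewrite !mulr1n geC0_conj// sqrtC_ge0.
  by rewrite !mulr0n conjC0.
rewrite /absmx; case: xgetP => [A -> []//|/(_ (P^t* *m diag_mx e *m P))] /=.
case; split; last first.
  rewrite -/M ME !mulmxA -(mulmxA _ P) PP mulmx1 -(mulmxA _ (diag_mx e) (diag_mx e)).
  congr (_ *m _ *m _); rewrite mulmx_diag; congr diag_mx.
  by apply/rowP => i; rewrite !mxE -expr2 sqrtCK.
split; first by apply: hermE; rewrite !tCM trmxCK eT mulmxA.
move=> v; have -> : v^t* *m (P^t* *m diag_mx e *m P) *m v =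
    (P *m v)^t* *m diag_mx e *m (P *m v) by rewrite tCM !mulmxA.
rewrite !mxE sumr_ge0// => i _; rewrite mul_mx_diag !mxE.
set a := (\sum_(j < n) _).
rewrite mulrAC mulr_ge0 ?sqrtC_ge0// mulrC; exact: mul_conjC_ge0.
Qed.

Lemma orthonormal_basis_ker m n (A : 'M[C]_(m, n)) :
  exists p (B : 'M[C]_(n, p)), orthonormal_basis B (kerset A).
Proof.
pose K := kermx A^T; pose P := schmidt (row_base K).
have leK : (\rank K <= n)%N by exact: rank_leq_col.
exists (\rank K), P^T; split.
  have /unitarymxP h : P \is unitarymx by exact: schmidt_unitarymx.
  by rewrite trmxK; apply: trmx_inj; rewrite trmx_mul trmxK trmx1 map_trmx.
have PK : (P :=: K)%MS.
  apply: eqmx_trans (eq_row_base K).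
  by apply: eqmx_schmidt_free; exact: row_base_free.
apply/seteqP; split => [v /= Av|_ [w _ <-]].
  have /submxP[D vD] : (v^T <= P)%MS.
    by rewrite PK; apply/sub_kermxP; rewrite -trmx_mul Av trmx0.
  by exists D^T => //; rewrite -trmx_mul -vD trmxK.
have /sub_kermxP h : (P <= K)%MS by rewrite PK.
by rewrite /kerset/= mulmxA -[A]trmxK -trmx_mul h trmx0 mul0mx.
Qed.

Lemma orthonormal_basis_orthocompl n (A : 'M[C]_n) :
  exists q (B : 'M[C]_(n, q)), orthonormal_basis B (orthocompl (kerset A)).
Proof.
have [p [B [_ BA]]] := orthonormal_basis_ker A.
suff -> : orthocompl (kerset A) = kerset (B^t*) by exact: orthonormal_basis_ker.
rewrite BA; apply/seteqP; split => v /= h.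
  apply/matrixP => i j; rewrite ord1.
  have /(h _) : [set B *m w | w in [set: 'cV[C]_p]] (col i B).
    by exists (delta_mx i 0) => //; rewrite colE.
  move=> /matrixP/(_ 0 0); rewrite !mxE => {2}<-.
  by apply: eq_bigr => k _; rewrite !mxE.
by move=> _ [w _ <-]; rewrite trmx_mul map_mxM -mulmxA h mulmx0.
Qed.

End MatrixAnalysis.

(* Main.v *)
(* A unitary curve g moves every unit vector v along a curve of the unit sphere
   whose speed is at most the spectral norm of the velocity of g, so angles on
   the sphere bound lengths of curves of unitaries from below. Let c be the norm
   of X. For v in S = ker (c - |X|), that is X^2 v = c^2 v, the real angle between
   v and U v is exactly c: hence d(I, U) = c, and along a minimal curve g t v is a
   minimal geodesic of the sphere. For c < pi that geodesic is unique, which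
   forces g t v = e^{itX} v. For c = pi it is a half great circle from v to - v
   through g (1/2) v, and applying the same argument to the adjoint curve shows
   that g (1/2) restricts to an anti-Hermitian unitary of S, that is i Y / pi with
   Y^2 = pi^2. In both cases g t maps S to S, hence is block diagonal. Conversely
   the block on S has speed exactly c and dominates the other one, so that every
   such block diagonal curve has length c. *)
Require Import Defs.
From HB Require Import structures.
From mathcomp Require Import all_boot all_order all_algebra.
From mathcomp Require Import sesquilinear spectral.
From mathcomp Require Import all_classical all_reals all_analysis.
From mathcomp.real_closed Require Import complex.
From mathcomp Require Import ring lra measurable_realfun.

Set Implicit Arguments.
Unset Strict Implicit.
Unset Printing Implicit Defensive.

Import Order.TTheory GRing.Theory Num.Theory.
Import numFieldNormedType.Exports.

Local Open Scope classical_set_scope.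
Local Open Scope ring_scope.
Local Open Scope complex_scope.
Local Open Scope sesquilinear_scope.

(** * The real inner product of C^n and the operator norm *)

Section EuclideanStructure.
Context {R : realType}.
Local Notation C := R[i].
Local Notation re := (@complex.Re R).
Local Notation im := (@complex.Im R).

(** The obstacle is that [acos] is not derivable at 1 and -1, while the cosine of the angle between
    v and g t v starts at 1. The angle is therefore replaced by acos((1 - d) <u, g t v>) with 0 < d
    < 1, which grows no faster than the speed of g wherever g is derivable; letting d tend to 0
    yields cos L <= <u, x>. From then on only lower bounds of real inner products occur, and an
    inner product >= 1 of two unit vectors makes them equal. Since |X| is positive, S is cut out by
    X^2 v = c^2 v; on it only the eigenvalues c and -c of X occur, so e^{itX} is the trigonometric
    expression cos(tc) + i (sin(tc) / c) X. For c = pi, what puts g (1/2) v back into S is U g (1/2)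
    v = - g (1/2) v: as the norm of X is at most pi, the eigenspace of U for -1 lies in S.
    Derivatives are only available off an unspecified finite set, so every estimate of an increment
    is a monotonicity statement for a continuous function with finitely many exceptional points. *)

Lemma reD (x y : C) : re (x + y) = re x + re y.
Proof. by case: x; case: y. Qed.

Lemma imD (x y : C) : im (x + y) = im x + im y.
Proof. by case: x; case: y. Qed.

Lemma reN (x : C) : re (- x) = - re x. Proof. by case: x. Qed.

Lemma imN (x : C) : im (- x) = - im x. Proof. by case: x. Qed.

Lemma re_sum (I : Type) (r : seq I) (P : pred I) (F : I -> C) :
  re (\sum_(i <- r | P i) F i) = \sum_(i <- r | P i) re (F i).
Proof. by elim/big_rec2: _ => // i x y _ <-; rewrite reD. Qed.

Lemma im_sum (I : Type) (r : seq I) (P : pred I) (F : I -> C) :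
  im (\sum_(i <- r | P i) F i) = \sum_(i <- r | P i) im (F i).
Proof. by elim/big_rec2: _ => // i x y _ <-; rewrite imD. Qed.

Lemma reM (x y : C) : re (x * y) = re x * re y - im x * im y.
Proof. by case: x; case: y. Qed.

Lemma imM (x y : C) : im (x * y) = re x * im y + im x * re y.
Proof. by case: x; case: y. Qed.

Lemma re_conj (x : C) : re (Num.conj x) = re x.
Proof. by case: x. Qed.

Lemma im_conj (x : C) : im (Num.conj x) = - im x.
Proof. by case: x. Qed.

Lemma conjC_real (a : R) : Num.conj (a%:C : C) = a%:C.
Proof. by rewrite -[LHS]/(a -i* 0) oppr0. Qed.

Lemma conjC_i : Num.conj ('i : C) = - 'i.
Proof. by rewrite -[LHS]/(0 -i* 1) -[RHS]/((- 0) -i* 1) oppr0. Qed.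

Lemma complex_eq (x y : C) : re x = re y -> im x = im y -> x = y.
Proof. by case: x y => [a b] [c d] /= -> ->. Qed.

Lemma adjmxM m n p (A : 'M[C]_(m, n)) (B : 'M[C]_(n, p)) :
  (A *m B)^t* = B^t* *m A^t*.
Proof. by rewrite trmx_mul map_mxM. Qed.

Lemma adjmxD m n (A B : 'M[C]_(m, n)) : (A + B)^t* = A^t* + B^t*.
Proof. by apply/matrixP => i j; rewrite !mxE rmorphD. Qed.

Lemma adjmxZ m n (a : C) (A : 'M[C]_(m, n)) : (a *: A)^t* = Num.conj a *: A^t*.
Proof. by apply/matrixP => i j; rewrite !mxE rmorphM. Qed.

Lemma adjmx1 n : (1%:M : 'M[C]_n)^t* = 1%:M.
Proof. by rewrite trmx1 map_mx1. Qed.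

Lemma adjmx0 m n : (0 : 'M[C]_(m, n))^t* = 0.
Proof. by apply/matrixP => i j; rewrite !mxE rmorph0. Qed.

Lemma hermsymmxE n (A : 'M[C]_n) : (A \is hermsymmx) = (A^t* == A).
Proof.
by apply/is_hermitianmxP/eqP; rewrite expr0 scale1r => /esym.
Qed.

(** The Euclidean inner product of C^n regarded as R^{2n}: distances on the unit sphere are real
    angles. *)
Definition rdot n (u v : 'cV[C]_n) : R := re ((u^t* *m v) 0 0).

Lemma rdotE n (u v : 'cV[C]_n) :
  rdot u v = \sum_i (re (u i 0) * re (v i 0) + im (u i 0) * im (v i 0)).
Proof.
rewrite /rdot mxE re_sum; apply: eq_bigr => i _.
by rewrite !mxE reM re_conj im_conj mulNr opprK.
Qed.

Lemma rdotC n (u v : 'cV[C]_n) : rdot u v = rdot v u.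
Proof.
by rewrite !rdotE; apply: eq_bigr => i _; rewrite mulrC [im _ * _]mulrC.
Qed.

Lemma rdotDr n (u v w : 'cV[C]_n) : rdot u (v + w) = rdot u v + rdot u w.
Proof. by rewrite /rdot mulmxDr mxE reD. Qed.

Lemma rdotNr n (u v : 'cV[C]_n) : rdot u (- v) = - rdot u v.
Proof. by rewrite /rdot mulmxN mxE reN. Qed.

Lemma rdotZr n a (u v : 'cV[C]_n) : rdot u (a%:C *: v) = a * rdot u v.
Proof. by rewrite /rdot -scalemxAr mxE reM /= mul0r subr0. Qed.

Lemma rdotDl n (u v w : 'cV[C]_n) : rdot (u + v) w = rdot u w + rdot v w.
Proof. by rewrite ![rdot _ w]rdotC rdotDr. Qed.

Lemma rdotNl n (u v : 'cV[C]_n) : rdot (- u) v = - rdot u v.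
Proof. by rewrite ![rdot _ v]rdotC rdotNr. Qed.

Lemma rdotZl n a (u v : 'cV[C]_n) : rdot (a%:C *: u) v = a * rdot u v.
Proof. by rewrite ![rdot _ v]rdotC rdotZr. Qed.

Lemma rdot_adj m n (A : 'M[C]_(m, n)) u v :
  rdot (A *m u) v = rdot u (A^t* *m v).
Proof. by rewrite /rdot adjmxM mulmxA. Qed.

Lemma rdot_ge0 n (u : 'cV[C]_n) : 0 <= rdot u u.
Proof. by rewrite rdotE sumr_ge0// => i _; rewrite addr_ge0// -expr2 sqr_ge0. Qed.

Lemma rdot_eq0 n (u : 'cV[C]_n) : rdot u u = 0 -> u = 0.
Proof.
rewrite rdotE => /eqP; rewrite psumr_eq0; last first.
  by move=> i _; rewrite addr_ge0// -expr2 sqr_ge0.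
move=> /allP h; apply/matrixP => i j; rewrite ord1 mxE.
have := h i (mem_index_enum _).
rewrite paddr_eq0 -?expr2 ?sqr_ge0// !sqrf_eq0 => /andP[/eqP a /eqP b].
exact: complex_eq.
Qed.

Lemma normc_sqr (x : C) : Normc.normc x ^+ 2 = re x ^+ 2 + im x ^+ 2.
Proof. by case: x => a b; rewrite sqr_sqrtr// addr_ge0 ?sqr_ge0. Qed.

Lemma l2normE n (v : 'cV[C]_n) : l2norm v = Num.sqrt (rdot v v).
Proof.
rewrite /l2norm rdotE; congr Num.sqrt; apply: eq_bigr => i _.
by rewrite normc_sqr !expr2.
Qed.

Lemma sqr_l2norm n (v : 'cV[C]_n) : l2norm v ^+ 2 = rdot v v.
Proof. by rewrite l2normE sqr_sqrtr// rdot_ge0. Qed.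

Lemma l2norm_ge0 n (v : 'cV[C]_n) : 0 <= l2norm v.
Proof. exact: sqrtr_ge0. Qed.

Lemma l2norm0 n : l2norm (0 : 'cV[C]_n) = 0.
Proof. by rewrite l2normE /rdot mulmx0 mxE sqrtr0. Qed.

Lemma l2norm_eq0 n (v : 'cV[C]_n) : l2norm v = 0 -> v = 0.
Proof. by move=> h; apply: rdot_eq0; rewrite -sqr_l2norm h expr0n. Qed.

Lemma CauchySchwarz_rdot_sqr n (u v : 'cV[C]_n) :
  rdot u v ^+ 2 <= rdot u u * rdot v v.
Proof.
have := rdot_ge0 v; rewrite le_eqVlt => /predU1P[/esym v0|v0].
  by rewrite (rdot_eq0 v0) /rdot !mulmx0 mxE expr0n mulr0.
(* This vector is |v|^2 times the component of u orthogonal to v; its squared norm is |v|^2 (|u|^2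
   |v|^2 - <u, v>^2). *)
have := rdot_ge0 ((rdot v v)%:C *: u - (rdot u v)%:C *: v).
rewrite rdotDr rdotNr !rdotDl !rdotNl !rdotZr !rdotZl [rdot v u]rdotC.
move: v0; move: (rdot u u) (rdot u v) (rdot v v) => a b c v0.
have -> : c * (c * a) + - (c * (b * b)) - (b * (c * b) + - (b * (b * c))) =
  c * (a * c - b ^+ 2) by ring.
by rewrite pmulr_rge0// subr_ge0.
Qed.

Lemma CauchySchwarz_rdot n (u v : 'cV[C]_n) : rdot u v <= l2norm u * l2norm v.
Proof.
rewrite (le_trans (ler_norm _))// -sqrtr_sqr !l2normE -sqrtrM ?rdot_ge0//.
exact/ler_wsqrtr/CauchySchwarz_rdot_sqr.
Qed.

Lemma l2normD n (u v : 'cV[C]_n) : l2norm (u + v) <= l2norm u + l2norm v.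
Proof.
rewrite -(@ler_pXn2r _ 2) ?nnegrE ?addr_ge0 ?l2norm_ge0//.
rewrite sqr_l2norm rdotDr !rdotDl [rdot v u]rdotC sqrrD !sqr_l2norm.
have := CauchySchwarz_rdot u v; lra.
Qed.

Lemma l2normZ n (a : C) (v : 'cV[C]_n) :
  l2norm (a *: v) = Normc.normc a * l2norm v.
Proof.
apply/eqP; rewrite -(@eqrXn2 _ 2) ?mulr_ge0 ?l2norm_ge0 ?sqrtr_ge0//; last first.
  by case: a => x y; exact: sqrtr_ge0.
rewrite exprMn normc_sqr !sqr_l2norm !rdotE mulr_sumr; apply/eqP/eq_bigr => i _.
rewrite !mxE reM imM; ring.
Qed.

Lemma normc_real (a : R) : Normc.normc a%:C = `|a|.
Proof. by rewrite /Normc.normc/= expr0n addr0 sqrtr_sqr. Qed.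

(** |x - y|^2 = 2 - 2 <x, y>. The rigidity arguments below all end with this equality case. *)
Lemma eq_unit_rdot n (x y : 'cV[C]_n) :
  rdot x x = 1 -> rdot y y = 1 -> 1 <= rdot x y -> x = y.
Proof.
move=> x1 y1 xy; apply/eqP; rewrite -subr_eq0; apply/eqP/rdot_eq0/eqP.
rewrite eq_le rdot_ge0 andbT.
rewrite rdotDr rdotNr !rdotDl !rdotNl x1 y1 [rdot y x]rdotC; lra.
Qed.

Lemma rdot_unitary n (A : 'M[C]_n) u v :
  A \is unitarymx -> rdot (A *m u) (A *m v) = rdot u v.
Proof.
rewrite -trmxC_unitary => /unitarymxP; rewrite trmxCK => h.
by rewrite rdot_adj mulmxA h mul1mx.
Qed.

Lemma rdot_isometry m n (B : 'M[C]_(m, n)) u v :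
  B^t* *m B = 1%:M -> rdot (B *m u) (B *m v) = rdot u v.
Proof. by move=> h; rewrite rdot_adj mulmxA h mul1mx. Qed.

(** A crude entrywise majorant: it bounds the set whose supremum is [opnorm], and it transfers
    continuity of the entries to [opnorm]. *)
Definition l1norm m n (A : 'M[C]_(m, n)) : R := \sum_i \sum_j Normc.normc (A i j).

Lemma normc_ge0 (x : C) : 0 <= Normc.normc x.
Proof. by case: x => a b; exact: sqrtr_ge0. Qed.

Lemma l1norm_ge0 m n (A : 'M[C]_(m, n)) : 0 <= l1norm A.
Proof. by do 2!(apply: sumr_ge0 => ? _); exact: normc_ge0. Qed.

Lemma normc_le_l2norm n (v : 'cV[C]_n) i : Normc.normc (v i 0) <= l2norm v.
Proof.
rewrite -(@ler_pXn2r _ 2) ?nnegrE ?l2norm_ge0 ?normc_ge0// sqr_sqrtr; last first.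
  by rewrite sumr_ge0// => j _; rewrite sqr_ge0.
by rewrite (bigD1 i)//= lerDl sumr_ge0// => j _; rewrite sqr_ge0.
Qed.

Lemma normc_sum_le (I : Type) (r : seq I) (P : pred I) (F : I -> C) :
  Normc.normc (\sum_(i <- r | P i) F i) <= \sum_(i <- r | P i) Normc.normc (F i).
Proof.
elim/big_rec2: _ => [|i x y _ h]; first by rewrite Normc.normc0.
by rewrite (le_trans (le_normcD _ _))// lerD2l.
Qed.

Lemma l2norm_le_l1 n (v : 'cV[C]_n) : l2norm v <= \sum_i Normc.normc (v i 0).
Proof.
rewrite -(@ler_pXn2r _ 2) ?nnegrE ?l2norm_ge0//; last first.
  by rewrite sumr_ge0// => i _; exact: normc_ge0.
rewrite sqr_sqrtr; last by rewrite sumr_ge0// => j _; rewrite sqr_ge0.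
rewrite [leRHS]expr2 mulr_suml; apply: ler_sum => i _.
rewrite expr2 ler_wpM2l ?normc_ge0// (bigD1 i)//= lerDl.
by rewrite sumr_ge0// => j _; exact: normc_ge0.
Qed.

Lemma l2norm_mulmx_l1 m n (A : 'M[C]_(m, n)) v :
  l2norm (A *m v) <= l1norm A * l2norm v.
Proof.
rewrite (le_trans (l2norm_le_l1 _))// mulr_suml ler_sum// => i _.
rewrite mxE (le_trans (normc_sum_le _ _ _))// mulr_suml ler_sum// => j _.
by rewrite Normc.normcM ler_wpM2l ?normc_ge0// normc_le_l2norm.
Qed.

Lemma has_sup_opnorm m n (A : 'M[C]_(m, n)) :
  has_sup [set l2norm (A *m v) | v in [set v : 'cV[C]_n | l2norm v <= 1]].
Proof.
split; first by exists (l2norm (A *m 0)), 0 => //=; rewrite l2norm0.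
exists (l1norm A) => _ [v /= v1 <-]; rewrite (le_trans (l2norm_mulmx_l1 _ _))//.
by rewrite ler_piMr// l1norm_ge0.
Qed.

Lemma opnorm_ge0 m n (A : 'M[C]_(m, n)) : 0 <= opnorm A.
Proof.
apply: (@le_trans _ _ (l2norm (A *m 0))); first exact: l2norm_ge0.
by apply: (ub_le_sup (has_sup_opnorm A).2); exists 0 => //=; rewrite l2norm0.
Qed.

Lemma l2norm_mulmx m n (A : 'M[C]_(m, n)) v :
  l2norm (A *m v) <= opnorm A * l2norm v.
Proof.
have [v0|v0] := eqVneq (l2norm v) 0.
  by rewrite (l2norm_eq0 v0) mulmx0 !l2norm0 mulr0.
have vp : 0 < l2norm v by rewrite lt_def v0 l2norm_ge0.
rewrite -ler_pdivrMr//.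
have -> : l2norm (A *m v) / l2norm v = l2norm (A *m ((l2norm v)^-1%:C *: v)).
  rewrite -scalemxAr l2normZ normc_real ger0_norm ?invr_ge0 ?l2norm_ge0//.
  by rewrite mulrC.
apply: (ub_le_sup (has_sup_opnorm A).2); exists ((l2norm v)^-1%:C *: v) => //=.
by rewrite l2normZ normc_real ger0_norm ?invr_ge0 ?l2norm_ge0// mulVf.
Qed.

Lemma opnorm_le m n (A : 'M[C]_(m, n)) (k : R) : 0 <= k ->
  (forall v, l2norm (A *m v) <= k * l2norm v) -> opnorm A <= k.
Proof.
move=> k0 h; apply: ge_sup; first exact: (has_sup_opnorm A).1.
by move=> _ [v /= v1 <-]; rewrite (le_trans (h _))// ler_piMr.
Qed.

Lemma opnorm_ge m n (A : 'M[C]_(m, n)) (k : R) v : v != 0 ->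
  k * l2norm v <= l2norm (A *m v) -> k <= opnorm A.
Proof.
move=> v0 h; have vp : 0 < l2norm v.
  by rewrite lt_def l2norm_ge0 andbT; apply: contraNneq v0 => /l2norm_eq0 ->.
by rewrite -(ler_pM2r vp) (le_trans h)// l2norm_mulmx.
Qed.

Lemma opnorm_le_l1norm m n (A : 'M[C]_(m, n)) : opnorm A <= l1norm A.
Proof. by apply: opnorm_le; [exact: l1norm_ge0|exact: l2norm_mulmx_l1]. Qed.

Lemma opnormD m n (A B : 'M[C]_(m, n)) : opnorm (A + B) <= opnorm A + opnorm B.
Proof.
apply: opnorm_le => [|v]; first by rewrite addr_ge0// opnorm_ge0.
by rewrite mulmxDl (le_trans (l2normD _ _))// mulrDl lerD// l2norm_mulmx.
Qed.

Lemma ler_opnorm_dist m n (A B : 'M[C]_(m, n)) :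
  `|opnorm A - opnorm B| <= l1norm (A - B).
Proof.
have l1C : l1norm (B - A) = l1norm (A - B).
  apply: eq_bigr => i _; apply: eq_bigr => j _.
  by rewrite -[B - A]opprB mxE normcN.
rewrite ler_norml lerNl opprB; apply/andP; split; rewrite lerBlDr.
- rewrite -l1C; apply: le_trans (lerD (opnorm_le_l1norm _) (lexx _)).
  by apply: le_trans (opnormD _ _); rewrite subrK.
- apply: le_trans (lerD (opnorm_le_l1norm _) (lexx _)).
  by apply: le_trans (opnormD _ _); rewrite subrK.
Qed.

(** |A^* v|^2 = <A A^* v, v> is at most |A| |A^* v| |v|, and one factor |A^* v| cancels. *)
Lemma opnorm_adj m n (A : 'M[C]_(m, n)) : opnorm (A^t*) <= opnorm A.
Proof.
apply: opnorm_le => [|v]; first exact: opnorm_ge0.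
have := l2norm_ge0 (A^t* *m v); rewrite le_eqVlt => /predU1P[<-|h].
  by rewrite mulr_ge0 ?opnorm_ge0 ?l2norm_ge0.
rewrite -(ler_pM2r h) -expr2 sqr_l2norm -rdot_adj.
rewrite (le_trans (CauchySchwarz_rdot _ _))// mulrAC.
by rewrite ler_wpM2r ?l2norm_ge0// l2norm_mulmx.
Qed.

Lemma l2norm_unitary n (A : 'M[C]_n) v :
  A \is unitarymx -> l2norm (A *m v) = l2norm v.
Proof. by move=> h; rewrite !l2normE rdot_unitary. Qed.

Lemma l2norm_isometry m n (B : 'M[C]_(m, n)) v :
  B^t* *m B = 1%:M -> l2norm (B *m v) = l2norm v.
Proof. by move=> h; rewrite !l2normE rdot_isometry. Qed.

End EuclideanStructure.

(** * Functional calculus of Hermitian matrices and the exponential *)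

Section HermitianExponential.
Context {R : realType}.
Local Notation C := R[i].
Local Notation re := (@complex.Re R).
Local Notation im := (@complex.Im R).

Definition cis (x : R) : C := cos x +i* sin x.

Lemma expi_coeff (x : R) k :
  (k`!%:R : C)^-1 * ('i * x%:C) ^+ k = cos_coeff x k +i* sin_coeff x k.
Proof.
rewrite exprMn -rmorphXn/=.
have -> : (k`!%:R : C)^-1 = ((k`!%:R : R)^-1)%:C by rewrite fmorphV rmorph_nat.
have -> : 'i ^+ k = if odd k then ((-1) ^+ k./2)%:C * 'i else ((-1) ^+ k./2)%:C :> C.
  rewrite -{1}(odd_double_half k) -mul2n exprD exprM sqr_i.
  by case: odd; rewrite ?expr0 ?mul1r ?expr1 rmorphXn rmorphN1 // mulrC.
rewrite /cos_coeff /sin_coeff/=; case: (boolP (odd k)) => ok /=.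
  have -> : (k.-1)./2 = k./2 by case: k ok => //= k; rewrite uphalf_half => /negbTE ->.
  by apply: complex_eq; rewrite !(reM, imM)/=; ring.
by apply: complex_eq; rewrite !(reM, imM)/=; rewrite -?exprnP; ring.
Qed.

Lemma cvg_expi_re (x : R) :
  (\sum_(0 <= k < N) re ((k`!%:R : C)^-1 * ('i * x%:C) ^+ k)) @[N --> \oo] --> cos x.
Proof.
under eq_cvg => N do under eq_bigr => k _ do rewrite expi_coeff.
rewrite unlock; exact: is_cvg_series_cos_coeff.
Qed.

Lemma cvg_expi_im (x : R) :
  (\sum_(0 <= k < N) im ((k`!%:R : C)^-1 * ('i * x%:C) ^+ k)) @[N --> \oo] --> sin x.
Proof.
under eq_cvg => N do under eq_bigr => k _ do rewrite expi_coeff.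
rewrite unlock; exact: is_cvg_series_sin_coeff.
Qed.

Definition eigs n (X : 'M[C]_n) (i : 'I_n) : R := re (spectral_diag X 0 i).

(** The functional calculus f(X) of a Hermitian X, read off its unitary diagonalization. *)
Definition spfun n (f : R -> C) (X : 'M[C]_n) : 'M[C]_n :=
  (spectralmx X)^t* *m diag_mx (\row_i f (eigs X i)) *m spectralmx X.

Lemma spectralmx_unitary n (X : 'M[C]_n) : spectralmx X *m (spectralmx X)^t* = 1%:M.
Proof. exact/unitarymxP/spectral_unitarymx. Qed.

Lemma spectralmx_unitaryC n (X : 'M[C]_n) : (spectralmx X)^t* *m spectralmx X = 1%:M.
Proof. exact/mulmx1C/spectralmx_unitary. Qed.

Lemma hermsym_spfun n (X : 'M[C]_n) : X \is hermsymmx ->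
  X = spfun (fun x => x%:C) X.
Proof.
move=> hX; have /orthomx_spectralP := hermitian_normalmx hX.
rewrite invmx_unitary ?spectral_unitarymx// => {1}->.
rewrite /spfun (_ : spectral_diag X = \row_i (eigs X i)%:C) //.
apply/rowP => i; rewrite [RHS]mxE /eigs.
have /mxOverP/(_ 0 i) := hermitian_spectral_diag_real hX.
by move=> /complex_realP[k ->].
Qed.

Lemma spfunZX n (X : 'M[C]_n) (a : C) k : X \is hermsymmx ->
  (a *: X) ^+ k = spfun (fun x => (a * x%:C) ^+ k) X.
Proof.
move=> hX; elim: k => [|k IH].
  rewrite expr0 /spfun.
  have -> : diag_mx (\row_i (a * (eigs X i)%:C) ^+ 0) = 1%:M.
    by apply/matrixP => i j; rewrite !mxE; case: eqP.
  by rewrite mulmx1 spectralmx_unitaryC.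
rewrite exprS IH -[_ * _]/((a *: X) *m _) {1}(hermsym_spfun hX) /spfun.
rewrite -scalemxAl -!mulmxA (mulmxA (spectralmx X)) spectralmx_unitary mul1mx.
rewrite (mulmxA (diag_mx _)) mulmx_diag scalemxAr scalemxAl; congr (_ *m (_ *m _)).
apply/matrixP => i j; rewrite !mxE; case: eqP => _; last by rewrite !mulr0n mulr0.
by rewrite !mulr1n exprS mulrA.
Qed.

Lemma spfunE n (X : 'M[C]_n) f j k :
  spfun f X j k =
  \sum_l ((spectralmx X l j)^* * spectralmx X l k) * f (eigs X l).
Proof.
rewrite /spfun mxE; apply: eq_bigr => l _; rewrite mul_mx_diag !mxE; ring.
Qed.

Lemma cvg_sumr {T I : Type} (F : set_system T) (r : seq I) (P : pred I)
    (f : I -> T -> R) (l : I -> R) : Filter F ->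
  (forall i, P i -> f i x @[x --> F] --> l i) ->
  \sum_(i <- r | P i) f i x @[x --> F] --> \sum_(i <- r | P i) l i.
Proof. by move=> FF h; apply: cvg_big => //; exact: add_continuous. Qed.

(** Each entry of a partial sum of the exponential series is a combination, with weights [w l]
    independent of the order, of the scalar partial sums at the eigenvalues; the limit is thus taken
    one eigenvalue at a time. *)
Lemma expmx_spfun n (X : 'M[C]_n) (t : R) : X \is hermsymmx ->
  expmx (('i * t%:C) *: X) = spfun (fun x => cis (t * x)) X.
Proof.
move=> hX; apply/matrixP => j k; rewrite mxE spfunE.
pose w l := ((spectralmx X l j)^* * spectralmx X l k).
pose E (N : nat) x := \sum_(0 <= m < N) (m`!%:R : C)^-1 * ('i * (t * x)%:C) ^+ m.
have SE N : (\sum_(m < N) (m`!%:R : C)^-1 *: (('i * t%:C) *: X) ^+ m) j k =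
    \sum_l w l * E N (eigs X l).
  rewrite summxE /E; under [RHS]eq_bigr do rewrite big_mkord mulr_sumr.
  rewrite exchange_big/=; apply: eq_bigr => m _.
  rewrite mxE (spfunZX _ _ hX) spfunE mulr_sumr; apply: eq_bigr => l _.
  by rewrite rmorphM/= /w !mulrA; ring.
apply: complex_eq => /=.
- apply/cvg_lim => //; rewrite re_sum.
  under eq_cvg => N do rewrite SE re_sum.
  apply: cvg_sumr => l _; rewrite reM.
  under eq_cvg => N do rewrite reM re_sum im_sum.
  by apply: cvgB; apply: cvgMr; [exact: cvg_expi_re|exact: cvg_expi_im].
- apply/cvg_lim => //; rewrite im_sum.
  under eq_cvg => N do rewrite SE im_sum.
  apply: cvg_sumr => l _; rewrite imM.
  under eq_cvg => N do rewrite imM re_sum im_sum.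
  by apply: cvgD; apply: cvgMr; [exact: cvg_expi_im|exact: cvg_expi_re].
Qed.

Lemma spfun_mul n p (X : 'M[C]_n) (f g : R -> C) (B : 'M[C]_(n, p)) :
  spfun f X *m (spfun g X *m B) = spfun (fun x => f x * g x) X *m B.
Proof.
rewrite mulmxA; congr (_ *m B); rewrite /spfun -!mulmxA.
rewrite (mulmxA _ (_^t*)) spectralmx_unitary mul1mx.
rewrite (mulmxA (diag_mx _)) mulmx_diag; congr (_ *m (diag_mx _ *m _)).
by apply/rowP => i; rewrite !mxE.
Qed.

(** Turns an operator identity on the range of B into scalar identities at those eigenvalues that
    contribute to B, and back. *)
Lemma eq_spfunP n p (X : 'M[C]_n) (f g : R -> C) (B : 'M[C]_(n, p)) :
  spfun f X *m B = spfun g X *m B <->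
  forall i k, f (eigs X i) * (spectralmx X *m B) i k =
              g (eigs X i) * (spectralmx X *m B) i k.
Proof.
rewrite /spfun -!mulmxA; set N := _ *m B; split=> [h i k|h].
  have := congr1 (mulmx (spectralmx X)) h.
  rewrite !(mulmxA _ (_^t*)) spectralmx_unitary !mul1mx => /matrixP/(_ i k).
  by rewrite !mul_diag_mx !mxE.
congr (_ *m _); apply/matrixP => i k; rewrite !mul_diag_mx.
by have := h i k; rewrite /N !mxE.
Qed.

Lemma spfunD n (X : 'M[C]_n) (f g : R -> C) :
  spfun (fun x => f x + g x) X = spfun f X + spfun g X.
Proof.
apply/matrixP => i j; rewrite [RHS]mxE !spfunE -big_split/=.
by apply: eq_bigr => l _; rewrite mulrDr.
Qed.

Lemma spfunZ n (X : 'M[C]_n) a (f : R -> C) :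
  spfun (fun x => a * f x) X = a *: spfun f X.
Proof.
apply/matrixP => i j; rewrite [RHS]mxE !spfunE mulr_sumr.
by apply: eq_bigr => l _; ring.
Qed.

Lemma spfun_cst n (X : 'M[C]_n) a : spfun (fun=> a) X = a%:M.
Proof.
rewrite -[LHS](_ : spfun (fun=> a * 1) X = _); last by rewrite mulr1.
rewrite spfunZ -scalemx1; congr (_ *: _).
rewrite -(spectralmx_unitaryC X) /spfun; congr (_ *m _).
rewrite -[RHS]mulmx1; congr (_ *m _).
by apply/matrixP => i j; rewrite !mxE; case: eqP.
Qed.

(** Only the eigenvalues c and -c contribute to B. At both, cos(tx) = cos(tc) and sin(tx) = (x / c)
    sin(tc), since cosine is even and sine is odd. *)
Lemma expmx_eigenspace n p (X : 'M[C]_n) (B : 'M[C]_(n, p)) (c t : R) :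
  X \is hermsymmx -> c != 0 -> X *m (X *m B) = (c ^+ 2)%:C *: B ->
  expmx (('i * t%:C) *: X) *m B =
  (cos (t * c))%:C *: B + ('i * (sin (t * c) / c)%:C) *: (X *m B).
Proof.
move=> hX c0 XXB; rewrite (expmx_spfun _ hX).
have -> : (cos (t * c))%:C *: B + ('i * (sin (t * c) / c)%:C) *: (X *m B) =
    spfun (fun x => (cos (t * c))%:C + ('i * (sin (t * c) / c)%:C) * x%:C) X *m B.
  by rewrite spfunD spfunZ spfun_cst mulmxDl mul_scalar_mx -scalemxAl -hermsym_spfun.
apply/eq_spfunP => i k; have : spfun (fun x => x%:C * x%:C) X *m B =
    spfun (fun=> (c ^+ 2)%:C) X *m B.
  by rewrite spfun_cst mul_scalar_mx -XXB -spfun_mul -hermsym_spfun.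
move/eq_spfunP => /(_ i k).
have [->|N0] := eqVneq ((spectralmx X *m B) i k) 0; first by rewrite !mulr0.
move=> /(mulIf N0); rewrite -rmorphM/= => /complexI/eqP.
rewrite -expr2 eqf_sqr => /orP[] /eqP ->; congr (_ * _); apply: complex_eq;
  rewrite ?(reD, imD, reM, imM)/= ?mulrN ?cosN ?sinN; field; exact: c0.
Qed.

Lemma eigs_le n (X : 'M[C]_n) i : X \is hermsymmx -> `|eigs X i| <= opnorm X.
Proof.
move=> hX; pose v := (spectralmx X)^t* *m delta_mx i 0 : 'cV[C]_n.
have vi : l2norm v = 1.
  rewrite l2norm_unitary ?trmxC_unitary ?spectral_unitarymx// l2normE rdotE.
  rewrite (bigD1 i)//= big1 ?addr0 => [|j /negPf ji].
    by rewrite mxE !eqxx/= mulr1 mulr0 addr0 sqrtr1.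
  by rewrite mxE ji/= !mulr0 addr0.
have Xv : X *m v = (eigs X i)%:C *: v.
  rewrite {1}(hermsym_spfun hX) /v /spfun -!mulmxA.
  rewrite (mulmxA (spectralmx X)) spectralmx_unitary mul1mx scalemxAr; congr (_ *m _).
  apply/matrixP => a b; rewrite mul_diag_mx !mxE ord1.
  by case: eqP => [->|_]; rewrite /= ?mulr0.
have := l2norm_mulmx X v.
by rewrite Xv l2normZ normc_real vi !mulr1.
Qed.

Lemma opnorm_spfun n (X : 'M[C]_n) f k : 0 <= k ->
  (forall i, Normc.normc (f (eigs X i)) <= k) -> opnorm (spfun f X) <= k.
Proof.
move=> k0 h; apply: opnorm_le => // v; rewrite /spfun -!mulmxA.
rewrite l2norm_unitary ?trmxC_unitary ?spectral_unitarymx//.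
rewrite -[in leRHS](l2norm_unitary v (spectral_unitarymx X)).
set w := _ *m v; rewrite -(@ler_pXn2r _ 2) ?nnegrE ?mulr_ge0 ?l2norm_ge0//.
rewrite exprMn !sqr_sqrtr ?sumr_ge0// => [|i _|i _]; rewrite ?sqr_ge0//.
rewrite mulr_sumr ler_sum// => i _; rewrite mul_diag_mx mxE mxE Normc.normcM exprMn.
by rewrite ler_wpM2r ?sqr_ge0// ler_pXn2r ?nnegrE ?normc_ge0.
Qed.

Lemma opnorm_max_eig n (X : 'M[C]_n) : (0 < n)%N -> X \is hermsymmx ->
  exists i, opnorm X = `|eigs X i|.
Proof.
case: n X => // n X _ hX.
have [i _ hi] := @Order.TotalTheory.arg_maxP _ _ 'I_n.+1 ord0 xpredT (fun i => `|eigs X i|) isT.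
exists i; apply/eqP; rewrite eq_le eigs_le// andbT.
rewrite {1}(hermsym_spfun hX); apply: opnorm_spfun => // j.
by rewrite normc_real; apply: hi.
Qed.

Lemma spfun_unitary n (X : 'M[C]_n) f : (forall x, f x * (f x)^* = 1) ->
  spfun f X \is unitarymx.
Proof.
move=> h; rewrite /spfun !mul_unitarymx ?trmxC_unitary ?spectral_unitarymx//.
apply/unitarymxP/matrixP => i j.
rewrite mul_diag_mx !mxE eq_sym; case: eqP => [->|_]; first by rewrite !mulr1n h.
by rewrite !mulr0n rmorph0 mulr0.
Qed.

Lemma cis_unitary x : cis x * (cis x)^* = 1.
Proof.
apply: complex_eq; rewrite ?(reM, imM) ?(re_conj, im_conj)/=; last by ring.
by rewrite mulrN opprK -!expr2 cos2Dsin2.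
Qed.

End HermitianExponential.

(** * Monotonicity and integrals off a finite set, and the arccosine estimates *)

Section RealCalculus.
Context {R : realType}.
Implicit Types (f G : R -> R) (s : seq R).
Local Notation mu := (@lebesgue_measure R).

(** Induction on s: an exceptional point inside the interval splits it in two, and continuity on the
    closed pieces makes the two inequalities compose. *)
Lemma nonincr_off_seq s f a b : a <= b -> {within `[a, b], continuous f} ->
  (forall t, a < t < b -> t \notin s -> derivable f t 1 /\ f^`()%classic t <= 0) ->
  f b <= f a.
Proof.
elim: s a b => [|x s IH] a b ab cf df.
  apply: (@ler0_derive1_nincr _ f a b) => // t; rewrite in_itv/= => tab;
    by have [] := df t tab isT.
have [/andP[ax xb]|nx] := boolP (a < x < b).
  apply: (le_trans (IH x b (ltW xb) _ _) (IH a x (ltW ax) _ _)).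
  - apply: continuous_subspaceW cf => t/=; rewrite !in_itv/= => /andP[xt ->].
    by rewrite (le_trans (ltW ax) xt).
  - move=> t /andP[xt tb] ts; apply: df; first by rewrite (lt_trans ax xt).
    by rewrite inE negb_or ts andbT gt_eqF.
  - apply: continuous_subspaceW cf => t/=; rewrite !in_itv/= => /andP[-> tx].
    by rewrite (le_trans tx (ltW xb)).
  - move=> t /andP[at_ tx] ts; apply: df; first by rewrite at_ (lt_trans tx xb).
    by rewrite inE negb_or ts andbT lt_eqF.
apply: IH => // t tab ts; apply: df => //; rewrite inE negb_or ts andbT.
by apply: contraNneq nx => <-.
Qed.

Lemma finite_measurable_fun (A : set R) f : finite_set A -> measurable_fun A f.
Proof.
move=> fA mA Y mY; apply: countable_measurable => [t|]; first exact: measurable_set1.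
by apply: finite_set_countable; apply: sub_finite_set fA => t [].
Qed.

Lemma itv01_split s : `[0, 1]%classic =
  (`]0, 1[%classic `\` [set` s]) `|` (`[0, 1]%classic `&` [set` [:: 0, 1 & s]]) :> set R.
Proof.
apply/seteqP; split=> [t|t [[]|[]]//]/=; rewrite !in_itv/=; last first.
  by move=> /andP[a b] _; rewrite !ltW.
move=> /andP[t0 t1]; rewrite !inE.
have [->|n0] := eqVneq t 0; first by right; rewrite lexx ler01.
have [->|n1] := eqVneq t 1; first by right; rewrite lexx ler01.
have [ts|ts] := boolP (t \in s); first by right; rewrite t0 t1.
left; split=> //.
by rewrite !lt_def n0 t0 t1 eq_sym n1.
Qed.

Lemma integrable_off_seq s f M :
  (forall t, 0 < t < 1 -> t \notin s -> {for t, continuous f} /\ 0 <= f t <= M) ->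
  mu.-integrable `[0, 1] (EFin \o f).
Proof.
(* f is uncontrolled at 0, 1 and on s, so K must dominate its values at these finitely many points
   as well as M. *)
move=> h; pose K := `|M| + \sum_(x <- [:: 0, 1 & s]) `|f x|.
have oO : open (`]0, 1[%classic `\` [set` s] : set R).
  rewrite setDE; apply: openI; first exact: interval_open.
  rewrite openC; apply: (accessible_finite_set_closed.1 _); last exact: finite_seq.
  exact/hausdorff_accessible/Rhausdorff.
have fN : finite_set (`[0, 1]%classic `&` [set` [:: 0, 1 & s]] : set R).
  by apply: (@sub_finite_set _ _ [set` [:: 0, 1 & s]]) => // t [].
apply: measurable_bounded_integrable => //.
- have := @lebesgue_measure_itv R `[0, 1]; rewrite /= lte_fin ltr01 => ->.
  by rewrite oppr0 adde0 ltry.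
- rewrite (itv01_split s); apply/measurable_funU.
  + exact: open_measurable.
  + by apply: countable_measurable => [t|]; [exact: measurable_set1|exact: finite_set_countable].
  + split; last exact: finite_measurable_fun.
    apply: open_continuous_measurable_fun => // t /set_mem[/= t01 ts].
    by apply: (h t _ _).1; [rewrite in_itv/= in t01|apply/negP].
- exists K; split; first exact: num_real.
  move=> x Kx t t01; apply: le_trans (ltW Kx).
  have S0 : 0 <= \sum_(x <- [:: 0, 1 & s]) `|f x| by rewrite sumr_ge0.
  move: t01; rewrite (itv01_split s) => -[[/= tI ts]|[_ /= ts]].
    rewrite in_itv/= in tI; have [|_ /andP[f0 fM]] := h t tI; first exact/negP.
    rewrite ger0_norm// (le_trans fM)// (le_trans (ler_norm _))//.
    by rewrite lerDl.
  rewrite /K (perm_big _ (perm_to_rem ts)) big_cons/=.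
  by rewrite addrCA lerDl addr_ge0// sumr_ge0.
Qed.

(** Let F be the integral of f from 0. Off s the fundamental theorem gives F' = f, so G - F has
    nonpositive derivative there and cannot increase. *)
Lemma increment_le_integral s f M G :
  (forall t, 0 < t < 1 -> t \notin s -> {for t, continuous f} /\ 0 <= f t <= M) ->
  {within `[0, 1], continuous G} ->
  (forall t, 0 < t < 1 -> t \notin s -> derivable G t 1 /\ G^`()%classic t <= f t) ->
  G 1 - G 0 <= \int[mu]_(t in `[0, 1]) f t.
Proof.
move=> h cG dG; have fi := integrable_off_seq h.
pose F (x : R) := \int[mu]_(t in `[0, x]) f t.
have F0 : F 0 = 0 by rewrite /F set_itv1 Rintegral_set1.
have : (G - F) 1 <= (G - F) 0.
  apply: (@nonincr_off_seq s) => //.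
    apply: within_continuousB => //.
    exact: parameterized_integral_continuous.
  move=> t t01 ts; have [dGt Gf] := dG t t01 ts; have [cf _] := h t t01 ts.
  have [/andP[t0 t1]] := t01.
  have [dF F'] := continuous_FTC1_closed t1 fi t0 cf.
  split; first exact: derivableB.
  rewrite derive1E (deriveB dGt dF) -!derive1E subr_le0.
  by apply: le_trans Gf _; rewrite -F'.
by rewrite !fctE F0 subr0 lerBlDr -lerBlDl.
Qed.

Lemma integral_le_off_seq s f k :
  (forall t, 0 < t < 1 -> t \notin s -> {for t, continuous f} /\ 0 <= f t <= k) ->
  \int[mu]_(t in `[0, 1]) f t <= k.
Proof.
move=> h; have fi := integrable_off_seq h.
pose F (x : R) := \int[mu]_(t in `[0, x]) f t.
have F0 : F 0 = 0 by rewrite /F set_itv1 Rintegral_set1.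
have : (F - (fun x => k * x)) 1 <= (F - (fun x => k * x)) 0.
  apply: (@nonincr_off_seq s) => //.
    apply: within_continuousB; first exact: parameterized_integral_continuous.
    by apply: continuous_subspaceT => t; apply: cvgMr; exact: cvg_id.
  move=> t t01 ts; have [cf /andP[_ fk]] := h t t01 ts.
  have [/andP[t0 t1]] := t01.
  have [dF F'] := continuous_FTC1_closed t1 fi t0 cf.
  have D : is_derive t 1 (fun x : R => k * x) k.
    by apply: is_derive_eq (is_deriveZ k (is_derive_id t 1)) _; exact: mulr1.
  split; first exact: (@ex_derive _ _ _ _ _ _ _ (is_deriveB (derivableP dF) D)).
  have := @derive_val _ _ _ _ _ _ _ (is_deriveB (derivableP dF) D).
  by rewrite derive1E => ->; rewrite subr_le0 -derive1E F'.
rewrite -[_ 1]/(F 1 - k * 1) -[_ 0]/(F 0 - k * 0).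
by rewrite F0 mulr1 mulr0 subr0 subr_le0.
Qed.

(** The passage to the limit d -> 0, done by contradiction at one well chosen d. The conclusion is
    stated with cosines, so no continuity of [acos] at the ends is needed. *)
Lemma cos_le_of_acos (x L : R) : -1 <= x <= 1 -> 0 <= L <= pi ->
  (forall d, 0 < d < 1 -> acos ((1 - d) * x) <= acos (1 - d) + L) -> cos L <= x.
Proof.
move=> /andP[x1 x2] /andP[L0 Lpi] h; rewrite leNgt; apply/negP => xL.
have cL1 : -1 < cos L by rewrite (le_lt_trans x1).
pose e := cos L - x; have e0 : 0 < e by rewrite subr_gt0.
(* The bound 1/2 gives (1 - d) e >= e / 2; the bound 1 + cos L keeps acos(1 - d) + L within [0, pi],
   where cosine decreases; the bound e^2 / 9 makes q = sin(acos(1 - d)) < e / 2, because q^2 <= 2 d.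
   The addition formula then gives (1 - d) e <= q sin L < e / 2. *)
pose d := Num.min (2^-1) (Num.min (1 + cos L) (e ^+ 2 / 9)).
have d0 : 0 < d.
  by rewrite !lt_min invr_gt0 ltr0n/= -ltrBlDl sub0r cL1/= divr_gt0 ?exprn_gt0.
have d2 : d <= 2^-1 by rewrite ge_min lexx.
have dL : d <= 1 + cos L by rewrite !ge_min lexx orbT.
have de : d <= e ^+ 2 / 9 by rewrite !ge_min lexx !orbT.
have d1 : d < 1 by lra.
have dI : -1 <= 1 - d <= 1 by apply/andP; split; lra.
have dxI : -1 <= (1 - d) * x <= 1 by apply/andP; split; nra.
have Apos := acos_ge0 dI.
have ALpi : acos (1 - d) + L <= pi.
  rewrite -lerBrDr leNgt; apply/negP.
  rewrite -ltr_cos ?in_itv/= ?acos_ge0 ?acos_lepi//; last first.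
    by rewrite subr_ge0 Lpi lerBlDr lerDl.
  by rewrite acosK ?in_itv//= cosB cospi sinpi mul0r addr0 mulN1r => ?; lra.
have : cos (acos (1 - d) + L) <= (1 - d) * x.
  rewrite leNgt; apply/negP.
  rewrite -[ltLHS](@acosK R) ?in_itv//=.
  rewrite ltr_cos ?in_itv/= ?acos_ge0 ?acos_lepi ?addr_ge0//.
  by rewrite ltNge h// d0 d1.
rewrite cosD acosK ?in_itv//= sin_acos//.
set q := Num.sqrt _; have q0 : 0 <= q := sqrtr_ge0 _.
have q2 : q ^+ 2 = 1 - (1 - d) ^+ 2.
  by rewrite sqr_sqrtr// subr_ge0 expr_le1//; lra.
have sL : 0 <= sin L by rewrite sin_ge0_pi// L0.
have sL1 : sin L <= 1 := sin_le1 L.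
have qe : q < e / 2.
  rewrite -(@ltr_pXn2r _ 2) ?nnegrE//; last by rewrite divr_ge0// ltW.
  rewrite q2 expr_div_n; nra.
rewrite leNgt => /negP; apply.
have : q * sin L <= q by rewrite ler_piMr.
have : (1 - d) * e >= e / 2 by nra.
have : (1 - d) * e = (1 - d) * cos L - (1 - d) * x by rewrite -mulrBr.
clearbody e d q; lra.
Qed.

(** The factor 1 - d keeps the argument of [acos] strictly inside (-1, 1), hence derivable, without
    spoiling the differential inequality |f'| <= l sqrt(1 - f^2). *)
Lemma is_derive_acos_scaled f t l d : 0 < d < 1 -> 0 <= l ->
  -1 <= f t <= 1 -> derivable f t 1 ->
  f^`()%classic t ^+ 2 <= (1 - f t ^+ 2) * l ^+ 2 ->
  derivable (fun x => acos ((1 - d) * f x)) t 1 /\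
  (fun x => acos ((1 - d) * f x))^`()%classic t <= l.
Proof.
move=> /andP[d0 d1] l0 /andP[f1 f2] df f'l.
have I : -1 < (1 - d) * f t < 1 by apply/andP; split; nra.
have D1 : is_derive t 1 ((1 - d) \*: f) ((1 - d) *: f^`()%classic t).
  by apply: is_deriveZ; rewrite derive1E; exact: derivableP.
have D2 := is_derive1_acos I.
have D : is_derive t 1 (acos \o ((1 - d) \*: f))
  (- (Num.sqrt (1 - ((1 - d) * f t) ^+ 2))^-1 * ((1 - d) *: f^`()%classic t)).
  exact: is_derive1_comp.
split; first exact: (@ex_derive _ _ _ _ _ _ _ D).
rewrite derive1E (@derive_val _ _ _ _ _ _ _ D).
set q := Num.sqrt _; have q2 : q ^+ 2 = 1 - ((1 - d) * f t) ^+ 2.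
  rewrite sqr_sqrtr// subr_ge0 -real_normK ?num_real// expr_le1//.
  by rewrite ler_norml; case/andP: I => /ltW -> /ltW ->.
have q0 : 0 < q.
  rewrite sqrtr_gt0 subr_gt0 -real_normK ?num_real// expr_lt1//.
  by rewrite ltr_norml.
rewrite mulNr -mulrN mulrC ler_pdivrMr// [_ *: _]/(_ * _).
apply: (le_trans (ler_norm _)).
rewrite -(@ler_pXn2r _ 2) ?nnegrE ?mulr_ge0 ?(ltW q0)//.
rewrite real_normK ?num_real// sqrrN !exprMn q2.
have : 0 <= l ^+ 2 by rewrite sqr_ge0.
have h : (1 - d) ^+ 2 <= 1 by rewrite expr_le1//; lra.
have h0 : 0 <= (1 - d) ^+ 2 by rewrite sqr_ge0.
have : (1 - d) ^+ 2 * (f^`()%classic t) ^+ 2 <= (1 - d) ^+ 2 * ((1 - f t ^+ 2) * l ^+ 2).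
  by rewrite ler_wpM2l.
move=> h1 h2; apply: (le_trans h1).
(* The room gained by scaling is exactly l^2 (1 - (1 - d)^2), which is nonnegative. *)
have -> : l ^+ 2 * (1 - ((1 - d) * f t) ^+ 2) =
  (1 - d) ^+ 2 * ((1 - f t ^+ 2) * l ^+ 2) + l ^+ 2 * (1 - (1 - d) ^+ 2) by ring.
by rewrite lerDl mulr_ge0// subr_ge0.
Qed.

End RealCalculus.

(** * Entrywise derivatives, continuity and smoothness of matrix-valued maps *)

Section LinearRelations.
Context {R : realType}.
Local Notation C := R[i].
Local Notation re := (@complex.Re R).
Local Notation im := (@complex.Im R).

(* A predicate on pairs (function, number) compatible with linear combinations:
   it covers "f is differentiable at t with derivative d" and, with the number
   ignored, smoothness and continuity. *)
Record linear_rel (K : (R -> R) -> R -> Prop) : Prop := LinearRel {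
  linrel0 : K (fun=> 0) 0 ;
  linrelD : forall f g a b, K f a -> K g b -> K (fun x => f x + g x) (a + b) ;
  linrelZ : forall c f a, K f a -> K (fun x => c * f x) (c * a) }.

(** Linearity over R, applied to real and imaginary parts separately, covers multiplication by
    complex constants and also conjugation, hence adjoints. *)
Definition crel (K : (R -> R) -> R -> Prop) (f : R -> C) (d : C) :=
  K (fun s => re (f s)) (re d) /\ K (fun s => im (f s)) (im d).

Definition mxrel (K : (R -> R) -> R -> Prop) m n (g : R -> 'M[C]_(m, n)) (D : 'M[C]_(m, n)) :=
  forall j k, crel K (fun s => g s j k) (D j k).

Section Closure.
Variable K : (R -> R) -> R -> Prop.
Hypothesis linK : linear_rel K.

Lemma crel0 : crel K (fun=> 0) 0.
Proof. by split; exact: linrel0. Qed.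

Lemma crelD f g a b : crel K f a -> crel K g b ->
  crel K (fun x => f x + g x) (a + b).
Proof.
move=> [f1 f2] [g1 g2]; split; rewrite ?reD ?imD.
- rewrite (_ : (fun s => _) = (fun s => re (f s) + re (g s))); first exact: linrelD.
  by apply/funext => s; rewrite reD.
- rewrite (_ : (fun s => _) = (fun s => im (f s) + im (g s))); first exact: linrelD.
  by apply/funext => s; rewrite imD.
Qed.

Lemma crelZ c f a : crel K f a -> crel K (fun x => c * f x) (c * a).
Proof.
move=> [f1 f2]; split; rewrite ?reM ?imM.
- rewrite (_ : (fun s => _) = (fun s => re c * re (f s) + (- im c) * im (f s))).
    by rewrite -mulNr; apply: linrelD => //; exact: linrelZ.
  by apply/funext => s; rewrite reM mulNr.
- rewrite (_ : (fun s => _) = (fun s => re c * im (f s) + im c * re (f s))).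
    by apply: linrelD => //; exact: linrelZ.
  by apply/funext => s; rewrite imM.
Qed.

Lemma crel_conj f a : crel K f a -> crel K (fun x => (f x)^*) (a^*).
Proof.
move=> [f1 f2]; split; rewrite ?re_conj ?im_conj.
- rewrite (_ : (fun s => _) = (fun s => re (f s))) //.
  by apply/funext => s; rewrite re_conj.
- rewrite (_ : (fun s => _) = (fun s => -1 * im (f s))).
    by rewrite -[- im a]mulN1r; exact: linrelZ.
  by apply/funext => s; rewrite im_conj mulN1r.
Qed.

Lemma crel_sum (I : Type) (r : seq I) (f : I -> R -> C) a :
  (forall i, crel K (f i) (a i)) ->
  crel K (fun x => \sum_(i <- r) f i x) (\sum_(i <- r) a i).
Proof.
move=> h; elim: r => [|i r IH].
  rewrite big_nil (_ : (fun x => _) = fun=> 0); first exact: crel0.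
  by apply/funext => x; rewrite big_nil.
rewrite big_cons (_ : (fun x => _) = fun x => f i x + \sum_(i <- r) f i x).
  exact: crelD.
by apply/funext => x; rewrite big_cons.
Qed.

Lemma mxrelD m n (g h : R -> 'M[C]_(m, n)) D E :
  mxrel K g D -> mxrel K h E -> mxrel K (fun s => g s + h s) (D + E).
Proof.
move=> gD hE j k; rewrite mxE.
rewrite (_ : (fun s => _) = fun s => g s j k + h s j k); first exact: crelD.
by apply/funext => s; rewrite mxE.
Qed.

Lemma mxrel_mull m n p (P : 'M[C]_(p, m)) (g : R -> 'M[C]_(m, n)) D :
  mxrel K g D -> mxrel K (fun s => P *m g s) (P *m D).
Proof.
move=> gD j k; rewrite mxE.
rewrite (_ : (fun s => _) = fun s => \sum_l P j l * g s l k).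
  by apply: crel_sum => l; exact: crelZ.
by apply/funext => s; rewrite mxE.
Qed.

Lemma mxrel_adj m n (g : R -> 'M[C]_(m, n)) D :
  mxrel K g D -> mxrel K (fun s => (g s)^t*) (D^t*).
Proof.
move=> gD j k; rewrite !mxE.
rewrite (_ : (fun s => _) = fun s => (g s k j)^*); first exact: crel_conj.
by apply/funext => s; rewrite !mxE.
Qed.

Lemma mxrel_mulr m n p (Q : 'M[C]_(n, p)) (g : R -> 'M[C]_(m, n)) D :
  mxrel K g D -> mxrel K (fun s => g s *m Q) (D *m Q).
Proof.
move=> gD j k; rewrite mxE.
rewrite (_ : (fun s => _) = fun s => \sum_l Q l k * g s j l).
  rewrite (eq_bigr (fun l => Q l k * D j l)) => [|l _]; last exact: mulrC.
  by apply: crel_sum => l; exact: crelZ.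
by apply/funext => s; rewrite mxE; apply: eq_bigr => l _; exact: mulrC.
Qed.

Lemma mxrel_scale m n (A : 'M[C]_(m, n)) f d :
  crel K f d -> mxrel K (fun s => f s *: A) (d *: A).
Proof.
move=> fd j k; rewrite mxE mulrC.
rewrite (_ : (fun s => _) = fun s => A j k * f s); first exact: crelZ.
by apply/funext => s; rewrite mxE mulrC.
Qed.

Lemma crel_mx m n (g : R -> 'M[C]_(m, n)) D (P : 'rV_m) (Q : 'cV_n) :
  mxrel K g D -> crel K (fun s => (P *m g s *m Q) 0 0) ((P *m D *m Q) 0 0).
Proof. by move=> gD; apply: mxrel_mulr; apply: mxrel_mull. Qed.

End Closure.

Definition has_deriv (t : R) (f : R -> R) d := is_derive t 1 f d.
Definition cont_on (a b : R) (f : R -> R) (_ : R) := {within `[a, b], continuous f}.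

Lemma linear_rel_has_deriv t : linear_rel (has_deriv t).
Proof.
split=> [|f g a b fa gb|c f a fa].
- exact: is_derive_cst.
- exact: is_deriveD.
- exact: is_deriveZ.
Qed.

Lemma linear_rel_cont_on a b : linear_rel (cont_on a b).
Proof.
split=> [|f g x y fc gc|c f x fc].
- by apply: continuous_subspaceT => t; exact: cvg_cst.
- exact: within_continuousD.
- by move=> t; apply: cvgMr; exact: fc.
Qed.

Lemma derive1nD (f g : R -> R) k : smooth f -> smooth g ->
  (fun x => f x + g x)^`(k)%classic =
  (fun x => f^`(k)%classic x + g^`(k)%classic x).
Proof.
move=> sf sg; elim: k => // k IH; rewrite derive1nS IH; apply/funext => x.
by rewrite derive1E (deriveD (sf k x) (sg k x)) -!derive1E -!derive1nS.
Qed.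

Lemma derive1nZ c (f : R -> R) k : smooth f ->
  (fun x => c * f x)^`(k)%classic = (fun x => c * f^`(k)%classic x).
Proof.
move=> sf; elim: k => // k IH; rewrite derive1nS IH; apply/funext => x.
by rewrite derive1E [LHS](deriveZ _ (sf k x)) -derive1E -derive1nS.
Qed.

Lemma linear_rel_smooth : linear_rel (fun f _ => smooth f).
Proof.
split=> [k x|f g _ _ sf sg k x|c f _ sf k x].
- suff -> : (fun=> 0)^`(k)%classic = (fun=> 0) :> (R -> R) by exact: derivable_cst.
  elim: k => // k IH; rewrite derive1nS IH; apply/funext => y.
  by rewrite derive1_cst.
- by rewrite derive1nD//; apply: derivableD; [exact: sf|exact: sg].
- by rewrite derive1nZ//; apply: derivableZ; exact: sf.
Qed.

(** The family a cos + b sin is stable under differentiation, so the induction on the order of the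
    derivative generalizes a and b. *)
Lemma smooth_trig (a b w : R) : smooth (fun x => a * cos (x * w) + b * sin (x * w)).
Proof.
move=> k; elim: k a b => [|k IH] a b x; last first.
  rewrite /derive1n iterSr -/(derive1n _ _).
  rewrite (_ : _^`()%classic = fun x => (b * w) * cos (x * w) + (- (a * w)) * sin (x * w)).
    exact: IH.
  apply/funext => y; rewrite derive1E.
  have D1 : is_derive y 1 (fun x : R => x * w) w.
    rewrite (_ : (fun x => _) = w \*: id); last by apply/funext => z; rewrite mulrC.
    by apply: is_derive_eq; exact: mulr1.
  have D2 : is_derive y 1 (fun x : R => cos (x * w)) (- sin (y * w) * w).
    exact: (@is_derive1_comp _ cos (fun x : R => x * w)).
  have D3 : is_derive y 1 (fun x : R => sin (x * w)) (cos (y * w) * w).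
    exact: (@is_derive1_comp _ sin (fun x : R => x * w)).
  have -> := @derive_val _ _ _ _ _ _ _ (is_deriveD (is_deriveZ a D2) (is_deriveZ b D3)).
  rewrite -[a *: _]/(a * _) -[b *: _]/(b * _); ring.
have D1 : derivable (fun x : R => x * w) x 1.
  rewrite (_ : (fun x => _) = w \*: id); last by apply/funext => z; rewrite mulrC.
  exact: derivableZ.
have D2 : derivable (fun x : R => cos (x * w)) x 1.
  exact: (@ex_derive _ _ _ _ _ _ _ (@is_derive1_comp _ cos (fun x : R => x * w) x _ _ _ (derivableP D1))).
have D3 : derivable (fun x : R => sin (x * w)) x 1.
  exact: (@ex_derive _ _ _ _ _ _ _ (@is_derive1_comp _ sin (fun x : R => x * w) x _ _ _ (derivableP D1))).
by apply: derivableD; apply: derivableZ.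
Qed.

Lemma smooth_cos w : smooth (fun x : R => cos (x * w)).
Proof.
rewrite (_ : (fun x => _) = fun x => 1 * cos (x * w) + 0 * sin (x * w)).
  exact: smooth_trig.
by apply/funext => x; rewrite mul1r mul0r addr0.
Qed.

Lemma smooth_sin w : smooth (fun x : R => sin (x * w)).
Proof.
rewrite (_ : (fun x => _) = fun x => 0 * cos (x * w) + 1 * sin (x * w)).
  exact: smooth_trig.
by apply/funext => x; rewrite mul1r mul0r add0r.
Qed.

Lemma mxderP n (g : R -> 'M[C]_n) t D :
  mxrel (has_deriv t) g D <-> mxderivable g t /\ mxderive g t = D.
Proof.
split=> [h|[dg <-] j k].
  split=> [j k|]; first by have [[? _] [? _]] := h j k.
  by apply/matrixP => j k; rewrite mxE; have [[_ a] [_ b]] := h j k;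
    apply: complex_eq; rewrite /= derive1E.
have [da db] := dg j k; rewrite mxE.
by split; (split; first by []); rewrite /= derive1E.
Qed.

Lemma mxder_near n (g h : R -> 'M[C]_n) t D : (\near t, g t = h t) ->
  mxrel (has_deriv t) g D -> mxrel (has_deriv t) h D.
Proof.
move=> gh gD j k; have [a b] := gD j k; split.
- by apply: near_eq_is_derive a; apply: filterS gh => s ->.
- by apply: near_eq_is_derive b; apply: filterS gh => s ->.
Qed.

Lemma speed_near n (g h : R -> 'M[C]_n) t : (\near t, g t = h t) -> mxderivable g t ->
  speed h t = speed g t.
Proof.
move=> gh dg; have /mxderP/(mxder_near gh)/mxderP[_ e] := conj dg (erefl (mxderive g t)).
by rewrite /speed e.
Qed.

Lemma cvg_dist0 (f : R -> R) (t : R) : {for t, continuous f} ->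
  `|f s - f t| @[s --> t] --> (0 : R).
Proof. by move=> cf; apply/norm_cvg0P/subr_cvg0; exact: cf. Qed.

Lemma continuous_opnorm n (D : R -> 'M[C]_n) t :
  (forall j k, {for t, continuous (fun s => re (D s j k))} /\
               {for t, continuous (fun s => im (D s j k))}) ->
  {for t, continuous (fun s => opnorm (D s))}.
Proof.
move=> h; pose e s := \sum_(j < n) \sum_(k < n)
  (`|re (D s j k) - re (D t j k)| + `|im (D s j k) - im (D t j k)|).
have : e s @[s --> t] --> \sum_(j < n) \sum_(k < n) ((0 : R) + 0).
  apply: cvg_sumr => j _; apply: cvg_sumr => k _.
  by have [a b] := h j k; apply: cvgD; exact: cvg_dist0.
rewrite big1 => [e0|j _]; last by rewrite big1// => k _; rewrite addr0.
have le_e s : `|opnorm (D t) - opnorm (D s)| <= e s.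
  rewrite distrC (le_trans (ler_opnorm_dist _ _))// ler_sum// => j _.
  rewrite ler_sum// => k _; rewrite !mxE.
  rewrite -(@ler_pXn2r _ 2) ?nnegrE ?normc_ge0 ?addr_ge0//.
  rewrite normc_sqr reD imD reN imN [leRHS]sqrrD !real_normK ?num_real//.
  by rewrite lerD2r lerDl mulrn_wge0// mulr_ge0.
apply/cvgrPdist_lt => eps eps0; near=> s.
rewrite (le_lt_trans (le_e s))//.
have -> : e s = `|0 - e s|.
  rewrite sub0r normrN ger0_norm// sumr_ge0// => j _.
  by rewrite sumr_ge0// => k _; rewrite addr_ge0.
near: s; by apply: cvgr_dist_lt.
Unshelve. all: by end_near. Qed.

End LinearRelations.

(** * Piecewise smooth curves, and the motion of a unit vector on the sphere *)

Section PiecewiseSmoothCurves.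
Context {R : realType}.
Local Notation C := R[i].
Local Notation re := (@complex.Re R).
Local Notation im := (@complex.Im R).

Lemma smooth_continuous (f : R -> R) k t : smooth f ->
  {for t, continuous f^`(k)%classic}.
Proof. by move=> sf; apply/differentiable_continuous/derivable1_diffP; exact: sf. Qed.

Lemma mxsmooth_derivable n (h : R -> 'M[C]_n) t : mxsmooth h -> mxderivable h t.
Proof. by move=> sh j k; have [a b] := sh j k; split; [exact: (a 0%N t)|exact: (b 0%N t)]. Qed.

Lemma mxsmooth_continuous_speed n (h : R -> 'M[C]_n) t : mxsmooth h ->
  {for t, continuous (speed h)}.
Proof.
move=> sh; apply: continuous_opnorm => j k; have [a b] := sh j k.
split.
- rewrite (_ : (fun s => _) = (fun s => re (h s j k))^`(1)%classic).
    exact: smooth_continuous.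
  by apply/funext => s; rewrite mxE.
- rewrite (_ : (fun s => _) = (fun s => im (h s j k))^`(1)%classic).
    exact: smooth_continuous.
  by apply/funext => s; rewrite mxE.
Qed.

Lemma mxsmooth_cont_on n (h : R -> 'M[C]_n) a b : mxsmooth h ->
  mxrel (cont_on a b) h 0.
Proof.
move=> sh j k; have [A B] := sh j k; split; apply: continuous_subspaceT => t.
- exact: (@smooth_continuous _ 0).
- exact: (@smooth_continuous _ 0).
Qed.

Lemma mxrel_cont_on_eq n (g h : R -> 'M[C]_n) a b : {in `[a, b], h =1 g} ->
  mxrel (cont_on a b) h 0 -> mxrel (cont_on a b) g 0.
Proof.
move=> e H j k; have [A B] := H j k; split.
- by apply: subspace_eq_continuous A => t /set_mem/= tab; rewrite /from_subspace/= e.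
- by apply: subspace_eq_continuous B => t /set_mem/= tab; rewrite /from_subspace/= e.
Qed.

(** What the estimates retain of piecewise smoothness: an exceptional finite list, a bounded
    continuous speed off it, and continuity throughout. The final 0 is a dummy, [cont_on] ignores
    it. *)
Definition regular_curve (a b : R) n (g : R -> 'M[C]_n) : Prop :=
  exists (s : seq R) (M : R),
  (forall t, a < t < b -> t \notin s ->
    [/\ mxderivable g t, {for t, continuous (speed g)} & 0 <= speed g t <= M]) /\
  mxrel (cont_on a b) g 0.

Lemma regular_piece n (g h : R -> 'M[C]_n) a b : a <= b -> mxsmooth h ->
  {in `[a, b], g =1 h} -> regular_curve a b g.
Proof.
move=> ab sh gh.
have [c _ hM] : exists2 c, c \in `[a, b] & forall t, t \in `[a, b] -> speed h t <= speed h c.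
  apply: EVT_max => //; apply: continuous_subspaceT => t.
  exact: mxsmooth_continuous_speed.
exists [::], (speed h c); split=> [t tab _|]; last first.
  by apply: mxrel_cont_on_eq (mxsmooth_cont_on a b sh) => t tab; rewrite gh.
have Nab : \near t, t \in `]a, b[ by apply: near_in_itvoo; rewrite in_itv.
have Ng : \near t, h t = g t.
  by apply: filterS Nab => u uab; rewrite gh//; exact: subset_itv_oo_cc.
have sE u : u \in `]a, b[ -> speed g u = speed h u.
  move=> uab; apply: speed_near; last exact: mxsmooth_derivable.
  apply: filterS (near_in_itvoo uab) => w wab; rewrite gh//.
  exact: subset_itv_oo_cc.
have tI : t \in `]a, b[ by rewrite in_itv.
split.
- have /mxderP/(mxder_near Ng)/mxderP[] // :=
    conj (mxsmooth_derivable t sh) (erefl (mxderive h t)).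
- rewrite /prop_for /continuous_at (sE t)//.
  have ct : speed h s @[s --> t] --> speed h t := mxsmooth_continuous_speed sh.
  apply: cvg_trans ct; apply: near_eq_cvg.
  by apply: filterS Nab => u uab; rewrite sE.
- apply/andP; split; first exact: opnorm_ge0.
  by rewrite (sE t tI); apply: hM; exact: subset_itv_oo_cc.
Qed.

Lemma regular_cat n (g : R -> 'M[C]_n) a x b : a <= x -> x <= b ->
  regular_curve a x g -> regular_curve x b g -> regular_curve a b g.
Proof.
move=> ax xb [s1 [M1 [h1 c1]]] [s2 [M2 [h2 c2]]].
exists (x :: s1 ++ s2), (Num.max M1 M2); split.
  move=> t /andP[at_ tb]; rewrite inE mem_cat !negb_or => /and3P[tx ts1 ts2].
  have [tlx|xt] := ltP t x.
    have [|//|? ? /andP[-> l]] := h1 t; first by rewrite at_ tlx.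
    by split=> //=; rewrite le_max l.
  have [|//|? ? /andP[-> l]] := h2 t; first by rewrite tb andbT lt_neqAle eq_sym tx.
  by split=> //=; rewrite le_max l orbT.
have U : `[a, b]%classic = `[a, x]%classic `|` `[x, b]%classic :> set R.
  apply/seteqP; split=> [t|t []]/=; rewrite !in_itv/= => /andP[l r].
  - by rewrite l r andbT; case: (leP t x) => [|/ltW]; [left|right].
  - by rewrite l (le_trans r).
  - by rewrite r (le_trans ax l).
move=> j k; have [A1 B1] := c1 j k; have [A2 B2] := c2 j k; split.
- by rewrite /cont_on U; apply: withinU_continuous => //; exact: interval_closed.
- by rewrite /cont_on U; apply: withinU_continuous => //; exact: interval_closed.
Qed.

Lemma piecewise_smooth_regular n (g : R -> 'M[C]_n) :
  piecewise_smooth g -> regular_curve 0 1 g.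
Proof.
move=> [s]; move: (0 : R) => a; elim: s a => [|x s IH] a ps h.
  have a1 := itv_partition_nil ps; rewrite a1.
  exists [::], 0; split=> [t /andP[t0 t1]|j k]; first by have := lt_trans t0 t1; rewrite ltxx.
  by split; rewrite /cont_on set_itv1; exact: continuous_subspace1.
have px := itv_partition_cons ps.
have ax : a <= x by case: ps => /=/andP[/ltW].
apply: (regular_cat ax (itv_partition_le px)).
- by have [//|h0 sh0 gh0] := h 0%N; apply: regular_piece sh0 gh0.
- by apply: IH => // i si; exact: (h i.+1).
Qed.

(** F may depend on the parameter, as is needed for block curves whose first block is itself a
    moving exponential. *)
Lemma piecewise_smooth_map m n (F : R -> 'M[C]_m -> 'M[C]_n) (g : R -> 'M[C]_m) :
  (forall h, mxsmooth h -> mxsmooth (fun s => F s (h s))) ->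
  piecewise_smooth g -> piecewise_smooth (fun s => F s (g s)).
Proof.
move=> HF [s ps h]; exists s => // i si; have [f sf gf] := h i si.
by exists (fun s => F s (f s)); [exact: HF|move=> t ti /=; rewrite gf].
Qed.

Lemma eq_piecewise_smooth n (g h : R -> 'M[C]_n) :
  (forall t, 0 <= t <= 1 -> g t = h t) -> piecewise_smooth g -> piecewise_smooth h.
Proof.
move=> gh [s ps H]; exists s => // i si; have [f sf gf] := H i si.
exists f => // t; rewrite in_itv/= => /andP[a b].
rewrite -gh ?gf ?in_itv/= ?a//.
have := itv_partition_nth_ge (m := i) (ltnW (si : (i.+1 < (size s).+1)%N)) ps.
have := itv_partition_nth_le (m := i.+1) si ps.
by move=> /(le_trans b) -> /le_trans -> .
Qed.

Lemma mxsmooth_piecewise_smooth n (g : R -> 'M[C]_n) : mxsmooth g -> piecewise_smooth g.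
Proof.
move=> sg; exists [:: 1]; first exact/itv_partition1/ltr01.
by case=> // _; exists g.
Qed.

Lemma increment_le_length n (g : R -> 'M[C]_n) (G : R -> R) : piecewise_smooth g ->
  {within `[0, 1], continuous G} ->
  (forall t, 0 < t < 1 -> mxderivable g t ->
     derivable G t 1 /\ G^`()%classic t <= speed g t) ->
  G 1 - G 0 <= curve_length g.
Proof.
move=> /piecewise_smooth_regular[s [M [h _]]] cG dG.
apply: (@increment_le_integral _ s _ M) => // [t t01 ts|t t01 ts].
- by have [] := h t t01 ts.
- by have [gt _ _] := h t t01 ts; exact: dG.
Qed.

Lemma increment_le_speed n (g : R -> 'M[C]_n) (G : R -> R) k : piecewise_smooth g ->
  {within `[0, 1], continuous G} ->
  (forall t, 0 < t < 1 -> mxderivable g t -> derivable G t 1 /\ G^`()%classic t <= k) ->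
  forall s t, 0 <= s -> s <= t -> t <= 1 -> G t - G s <= k * (t - s).
Proof.
move=> /piecewise_smooth_regular[r [M [h _]]] cG dG s t s0 st t1.
have : (G - (fun x => k * x)) t <= (G - (fun x => k * x)) s.
  apply: (@nonincr_off_seq _ r) => //.
    apply: within_continuousB.
      apply: continuous_subspaceW cG => u/=; rewrite !in_itv/= => /andP[su ut].
      by rewrite (le_trans s0 su) (le_trans ut t1).
    by apply: continuous_subspaceT => u; apply: cvgMr; exact: cvg_id.
  move=> u /andP[su ut] ur.
  have u01 : 0 < u < 1 by rewrite (le_lt_trans s0 su) (lt_le_trans ut t1).
  have [gu _ _] := h u u01 ur; have [dGu Gk] := dG u u01 gu.
  have D : is_derive u 1 (fun x : R => k * x) k.
    by apply: is_derive_eq (is_deriveZ k (is_derive_id u 1)) _; exact: mulr1.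
  split; first exact: (@ex_derive _ _ _ _ _ _ _ (is_deriveB (derivableP dGu) D)).
  have := @derive_val _ _ _ _ _ _ _ (is_deriveB (derivableP dGu) D).
  by rewrite derive1E => ->; rewrite subr_le0 -derive1E.
by rewrite -[_ t]/(G t - k * t) -[_ s]/(G s - k * s) mulrBr; lra.
Qed.

Lemma curve_length_ge0 n (g : R -> 'M[C]_n) : piecewise_smooth g -> 0 <= curve_length g.
Proof.
move=> pg; have := @increment_le_length n g (fun=> 0) pg; rewrite subrr; apply.
  by apply: continuous_subspaceT => t; exact: cvg_cst.
move=> t _ _; split; first exact: derivable_cst.
by rewrite derive1_cst; exact: opnorm_ge0.
Qed.

Lemma curve_length_le n (g : R -> 'M[C]_n) k : piecewise_smooth g ->
  (forall t, 0 < t < 1 -> mxderivable g t -> speed g t <= k) -> curve_length g <= k.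
Proof.
move=> /piecewise_smooth_regular[s [M [h _]]] gk.
apply: (@integral_le_off_seq _ s) => // t t01 ts.
by have [gt cg /andP[-> _]] := h t t01 ts; split=> //=; exact: gk.
Qed.

Lemma curve_length_cst n (g : R -> 'M[C]_n) k : piecewise_smooth g ->
  (forall t, 0 < t < 1 -> mxderivable g t -> speed g t = k) -> curve_length g = k.
Proof.
move=> pg gk; apply/eqP; rewrite eq_le; apply/andP; split.
  by apply: curve_length_le => // t t01 gt; rewrite gk.
have := @increment_le_length n g (fun x => k * x) pg; rewrite mulr1 mulr0 subr0; apply.
  by apply: continuous_subspaceT => u; apply: cvgMr; exact: cvg_id.
move=> t t01 gt; have D : is_derive t 1 (fun x : R => k * x) k.
  by apply: is_derive_eq (is_deriveZ k (is_derive_id t 1)) _; exact: mulr1.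
split; first exact: (@ex_derive _ _ _ _ _ _ _ D).
by rewrite derive1E (@derive_val _ _ _ _ _ _ _ D) gk.
Qed.

Lemma curve_length_speed_ge0 n (g : R -> 'M[C]_n) k : piecewise_smooth g ->
  (forall t, 0 < t < 1 -> mxderivable g t -> speed g t <= k) -> 0 <= k.
Proof.
by move=> pg h; apply: le_trans (curve_length_ge0 pg) (curve_length_le pg h).
Qed.

Section Sphere.
Variables (n : nat) (g : R -> 'M[C]_n).
Hypotheses (pg : piecewise_smooth g)
  (ug : forall t, 0 <= t <= 1 -> g t \is unitarymx).

Lemma is_derive_rdot (u v : 'cV[C]_n) t : mxderivable g t ->
  is_derive t 1 (fun s => rdot u (g s *m v)) (rdot u (mxderive g t *m v)).
Proof.
move=> gt; have /mxderP H := conj gt (erefl (mxderive g t)).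
have [+ _] := crel_mx (linear_rel_has_deriv t) (u^t*) v H.
by rewrite /rdot mulmxA; under eq_fun do rewrite -mulmxA.
Qed.

Lemma rdot_continuous (u v : 'cV[C]_n) :
  {within `[0, 1], continuous (fun s => rdot u (g s *m v))}.
Proof.
have [s [M [_ H]]] := piecewise_smooth_regular pg.
have [+ _] := crel_mx (linear_rel_cont_on 0 1) (u^t*) v H.
by under eq_fun do rewrite -mulmxA.
Qed.

Lemma rdot_curve_bound (u v : 'cV[C]_n) t : rdot u u = 1 -> rdot v v = 1 ->
  0 <= t <= 1 -> -1 <= rdot u (g t *m v) <= 1.
Proof.
move=> u1 v1 t01; rewrite -ler_norml -(@ler_pXn2r _ 2) ?nnegrE//.
rewrite real_normK ?num_real// expr1n (le_trans (CauchySchwarz_rdot_sqr _ _))//.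
by rewrite u1 rdot_unitary ?ug// v1 mulr1.
Qed.

(** Differentiate |g s v|^2 = 1, valid for all s near the interior point t. *)
Lemma velocity_orthogonal (v : 'cV[C]_n) t : rdot v v = 1 -> 0 < t < 1 ->
  mxderivable g t -> rdot (g t *m v) (mxderive g t *m v) = 0.
Proof.
move=> v1 t01 gt; have /mxderP H := conj gt (erefl (mxderive g t)).
have {H}H := mxrel_mulr (linear_rel_has_deriv t) v H.
pose F i (s : R) := re ((g s *m v) i 0) * re ((g s *m v) i 0) +
                    im ((g s *m v) i 0) * im ((g s *m v) i 0).
pose d i := 2 * (re ((g t *m v) i 0) * re ((mxderive g t *m v) i 0) +
                 im ((g t *m v) i 0) * im ((mxderive g t *m v) i 0)).
have DF i : is_derive t 1 (F i) (d i).
  have [a b] := H i 0.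
  apply: is_derive_eq (is_deriveD (is_deriveM a a) (is_deriveM b b)) _.
  by rewrite /GRing.scale/= /d; ring.
have D := is_derive_sum DF.
have D0 : is_derive t 1 (cst 1 : R -> R) (\sum_(i < n) d i).
  apply: near_eq_is_derive D; have tI : t \in `]0, 1[ by rewrite in_itv.
  apply: filterS (near_in_itvoo tI) => s; rewrite in_itv/= => /andP[s0 s1].
  by rewrite fct_sumE /= -rdotE rdot_unitary// ug// !ltW.
have := @derive_val _ _ _ _ _ _ _ D0; rewrite derive_cst rdotE -mulr_sumr => /esym/eqP.
by rewrite mulf_eq0 pnatr_eq0/= => /eqP.
Qed.

(** The velocity D is orthogonal to x = g t v, so u may be replaced by its tangential part w = u -
    <u, x> x, of squared norm 1 - <u, x>^2; Cauchy-Schwarz concludes. *)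
Lemma derive_rdot_bound (u v : 'cV[C]_n) t : rdot u u = 1 -> rdot v v = 1 ->
  0 < t < 1 -> mxderivable g t ->
  rdot u (mxderive g t *m v) ^+ 2 <= (1 - rdot u (g t *m v) ^+ 2) * speed g t ^+ 2.
Proof.
move=> u1 v1 t01 gt; set D := mxderive g t *m v; set x := g t *m v.
have t01' : 0 <= t <= 1 by case/andP: t01 => /ltW -> /ltW ->.
have xD : rdot x D = 0 by exact: velocity_orthogonal.
have x1 : rdot x x = 1 by rewrite rdot_unitary ?ug.
pose f := rdot u x; pose w := u - f%:C *: x.
have -> : rdot u D = rdot w D by rewrite rdotDl rdotNl rdotZl xD mulr0 subr0.
apply: (le_trans (CauchySchwarz_rdot_sqr _ _)).
have -> : rdot w w = 1 - rdot u x ^+ 2.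
  rewrite rdotDr rdotNr !rdotDl !rdotNl !rdotZr !rdotZl u1 x1 [rdot x u]rdotC -/f.
  ring.
have : rdot D D <= speed g t ^+ 2.
  rewrite -sqr_l2norm ler_pXn2r ?nnegrE ?l2norm_ge0 ?opnorm_ge0//.
  by rewrite (le_trans (l2norm_mulmx _ _))// l2normE v1 sqrtr1 mulr1.
move=> h; apply: ler_wpM2l => //; rewrite subr_ge0 -/f.
have /andP[a b] := rdot_curve_bound u1 v1 t01'.
by rewrite -real_normK ?num_real// expr_le1// ler_norml a.
Qed.

(** The angle between u and g s v, with its cosine shrunk by 1 - d. *)
Let acos_rdot (d : R) (u v : 'cV[C]_n) s := acos ((1 - d) * rdot u (g s *m v)).

Lemma continuous_acos_rdot d u v : 0 < d < 1 -> rdot u u = 1 -> rdot v v = 1 ->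
  {within `[0, 1], continuous (acos_rdot d u v)}.
Proof.
move=> /andP[d0 d1] u1 v1.
apply: (@within_continuous_comp _ _ _ _ (fun s => (1 - d) * rdot u (g s *m v)) acos).
  move=> x /set_mem[s /= s01 <-]; apply: continuous_acos.
  have /andP[a b] := rdot_curve_bound u1 v1 s01.
  by apply/andP; split; nra.
by move=> s; apply: cvgMr; exact: rdot_continuous.
Qed.

Lemma derive_acos_rdot d u v t : 0 < d < 1 -> rdot u u = 1 -> rdot v v = 1 ->
  0 < t < 1 -> mxderivable g t ->
  derivable (acos_rdot d u v) t 1 /\ (acos_rdot d u v)^`()%classic t <= speed g t.
Proof.
move=> d01 u1 v1 t01 gt.
have t01' : 0 <= t <= 1 by case/andP: t01 => /ltW -> /ltW ->.
have D := is_derive_rdot u v gt.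
apply: is_derive_acos_scaled => //; first exact: opnorm_ge0.
- exact: rdot_curve_bound.
- by rewrite derive1E (@derive_val _ _ _ _ _ _ _ D); exact: derive_rdot_bound.
Qed.

(** Taken with u = g 0 v, the shrunk angle starts at acos(1 - d) rather than 0 and increases by at
    most the length. *)
Lemma cos_length_le_rdot (v : 'cV[C]_n) : rdot v v = 1 -> curve_length g <= pi ->
  cos (curve_length g) <= rdot (g 0 *m v) (g 1 *m v).
Proof.
move=> v1 Lpi; have u0 : g 0 \is unitarymx by apply: ug; rewrite lexx ler01.
have u1 : rdot (g 0 *m v) (g 0 *m v) = 1 by rewrite rdot_unitary.
apply: cos_le_of_acos.
- by apply: rdot_curve_bound => //; rewrite lexx ler01.
- by rewrite curve_length_ge0.
- move=> d d01; rewrite -lerBlDl.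
  have := increment_le_length pg (continuous_acos_rdot d01 u1 v1)
    (fun t t01 => derive_acos_rdot d01 u1 v1 t01).
  by rewrite /acos_rdot u1 mulr1.
Qed.

(** The same comparison between two arbitrary times, with a speed bound in place of the length: this
    localized form is what rigidity requires. *)
Lemma cos_speed_le_rdot (v : 'cV[C]_n) k s t : rdot v v = 1 ->
  (forall t, 0 < t < 1 -> mxderivable g t -> speed g t <= k) ->
  0 <= s -> s <= t -> t <= 1 -> k * (t - s) <= pi ->
  cos (k * (t - s)) <= rdot (g s *m v) (g t *m v).
Proof.
move=> v1 gk s0 st t1 kpi.
have s01 : 0 <= s <= 1 by rewrite s0 (le_trans st).
have t01 : 0 <= t <= 1 by rewrite (le_trans s0 st).
have u1 : rdot (g s *m v) (g s *m v) = 1 by rewrite (rdot_unitary _ _ (ug s01)).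
have k0 := curve_length_speed_ge0 pg gk.
apply: cos_le_of_acos.
- exact: rdot_curve_bound.
- by rewrite kpi mulr_ge0// subr_ge0.
- move=> d d01; rewrite -lerBlDl.
  have := increment_le_speed pg (continuous_acos_rdot d01 u1 v1) _ s0 st t1.
  rewrite /acos_rdot u1 mulr1; apply => r r01 gr.
  have [? l] := derive_acos_rdot d01 u1 v1 r01 gr.
  by split=> //; rewrite (le_trans l)// gk.
Qed.

End Sphere.
End PiecewiseSmoothCurves.

(** * Positive square roots and the eigenspaces of X^2 *)

Section TopEigenspace.
Context {R : realType}.
Local Notation C := R[i].

Lemma mulmx_colP m n p (A B : 'M[C]_(m, n)) (Q : 'M[C]_(n, p)) :
  (forall w : 'cV[C]_p, A *m (Q *m w) = B *m (Q *m w)) -> A *m Q = B *m Q.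
Proof.
move=> h; apply/matrixP => i j; have := h (delta_mx j 0).
by rewrite !mulmxA -!colE => /matrixP/(_ i 0); rewrite !mxE.
Qed.

(** The columns of Q are themselves unit vectors, so testing on unit vectors suffices; the sphere
    estimates apply only to those. *)
Lemma mulmx_unitP m n p (A B : 'M[C]_(m, n)) (Q : 'M[C]_(n, p)) :
  Q^t* *m Q = 1%:M ->
  (forall w : 'cV[C]_p, rdot (Q *m w) (Q *m w) = 1 ->
     A *m (Q *m w) = B *m (Q *m w)) -> A *m Q = B *m Q.
Proof.
move=> Q1 h; apply/matrixP => i j; have := h (delta_mx j 0).
rewrite rdot_isometry// rdotE (bigD1 j)//= big1 => [|k /negPf kj]; last first.
  by rewrite mxE kj/= !mulr0 addr0.
rewrite mxE !eqxx/= mulr1 mulr0 !addr0 => /(_ erefl).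
by rewrite !mulmxA -!colE => /matrixP/(_ i 0); rewrite !mxE.
Qed.

Section PositiveSquareRoot.
Variables (n : nat) (A : 'M[C]_n).
Hypothesis psdA : psdmx A.

Lemma psdmx_herm : A^t* = A.
Proof. by have [h _] := psdA; apply/eqP; rewrite -hermsymmxE. Qed.

Lemma psdmx_rdot_ge0 (v : 'cV[C]_n) : 0 <= rdot v (A *m v).
Proof.
have [_ /(_ v)] := psdA; rewrite /rdot mulmxA lecE => /andP[_].
by rewrite raddf0.
Qed.

(** If A^2 v = k^2 v, then u = (k - A) v satisfies A u = - k u, and positivity of A with k > 0
    forces u = 0. *)
Lemma psdmx_ker (k : R) (v : 'cV[C]_n) : 0 < k ->
  (k%:C%:M - A) *m v = 0 <-> A *m (A *m v) = (k ^+ 2)%:C *: v.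
Proof.
move=> k0; split=> [|AAv].
  rewrite mulmxBl mul_scalar_mx => /eqP; rewrite subr_eq0 => /eqP kv.
  by rewrite -kv -scalemxAr -kv scalerA -rmorphM -expr2.
set u := _ *m v; have Au : A *m u = (- k)%:C *: u.
  rewrite /u mulmxBl mul_scalar_mx mulmxBr AAv -scalemxAr scalerBr scalerA.
  by rewrite -rmorphM/= mulNr -expr2 !rmorphN/= !scaleNr opprK addrC.
apply/rdot_eq0/eqP; rewrite eq_le rdot_ge0 andbT.
by have := psdmx_rdot_ge0 u; rewrite Au rdotZr mulNr oppr_ge0 pmulr_rle0.
Qed.

End PositiveSquareRoot.

(** [eigenvalue] refers to row vectors; taking adjoints turns them into column eigenvectors, a being
    real. *)
Lemma spectrum_hermP n (H : 'M[C]_n) (a : R) : H^t* = H ->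
  (spectrum H a%:C <-> exists2 v : 'cV[C]_n, v != 0 & H *m v = a%:C *: v).
Proof.
move=> Hh; have adj0 m1 m2 (v : 'M[C]_(m1, m2)) : (v^t* == 0) = (v == 0).
  apply/eqP/eqP => [h|->]; last exact: adjmx0.
  by rewrite -(trmxCK v) h adjmx0.
split=> [/eigenvalueP[v vH v0]|[v v0 Hv]].
  exists (v^t*); first by rewrite adj0.
  by rewrite -{1}Hh -adjmxM vH adjmxZ conjC_real.
apply/eigenvalueP; exists (v^t*); last by rewrite adj0.
by rewrite -{1}Hh -adjmxM Hv adjmxZ conjC_real.
Qed.

Section Hermitian.
Variables (n : nat) (X : 'M[C]_n).
Hypothesis hX : X \is hermsymmx.
Local Notation c := (opnorm X).

Lemma hermsym_adj : X^t* = X.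
Proof. by apply/eqP; rewrite -hermsymmxE. Qed.

Lemma top_eigenvector : (0 < n)%N ->
  exists2 v : 'cV[C]_n, rdot v v = 1 & X *m (X *m v) = (c ^+ 2)%:C *: v.
Proof.
move=> n0; have [i ci] := opnorm_max_eig n0 hX.
exists ((spectralmx X)^t* *m delta_mx i 0).
  rewrite rdot_isometry ?trmxCK ?spectralmx_unitary// rdotE.
  rewrite (bigD1 i)//= big1 => [|k /negPf ki]; last by rewrite mxE ki/= !mulr0 addr0.
  by rewrite mxE !eqxx/= mulr1 mulr0 !addr0.
rewrite {1 2}(hermsym_spfun hX) spfun_mul ci real_normK ?num_real//.
rewrite -mul_scalar_mx -(spfun_cst X); apply/eq_spfunP => k l.
rewrite mulmxA spectralmx_unitary mul1mx mxE.
by case: eqP => [->|_]; rewrite ?mulr0// -rmorphM/= expr2.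
Qed.

Lemma absmx_sqr (v : 'cV[C]_n) : absmx X *m (absmx X *m v) = X *m (X *m v).
Proof. by rewrite mulmxA (absmxP X).2 hermsym_adj mulmxA. Qed.

Lemma kerset_absmx k : 0 < k ->
  kerset (k%:C%:M - absmx X) = [set v | X *m (X *m v) = (k ^+ 2)%:C *: v].
Proof.
move=> k0; apply/seteqP; split=> v /=.
  by move/(psdmx_ker (absmxP X).1 v k0); rewrite absmx_sqr.
by rewrite -absmx_sqr => /(psdmx_ker (absmxP X).1 v k0).
Qed.

Lemma spectrum_absmxP k : 0 < k -> spectrum (absmx X) k%:C <->
  exists2 v : 'cV[C]_n, v != 0 & X *m (X *m v) = (k ^+ 2)%:C *: v.
Proof.
move=> k0; have Ah := psdmx_herm (absmxP X).1.
split=> [/(spectrum_hermP k Ah)[v v0 Av]|[v v0 Xv]].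
  by exists v => //; rewrite -absmx_sqr Av -scalemxAr Av scalerA -rmorphM -expr2.
apply/(spectrum_hermP k Ah); exists v => //.
move: Xv; rewrite -absmx_sqr => /(psdmx_ker (absmxP X).1 v k0)/eqP.
by rewrite mulmxBl mul_scalar_mx subr_eq0 eq_sym => /eqP.
Qed.

Lemma opnorm_ge_sqr_eigenvalue k (v : 'cV[C]_n) : v != 0 -> 0 <= k ->
  X *m (X *m v) = (k ^+ 2)%:C *: v -> k <= c.
Proof.
move=> v0 k0 XXv; apply: (opnorm_ge (v := v)) => //.
rewrite -(@ler_pXn2r _ 2) ?nnegrE ?mulr_ge0 ?l2norm_ge0//.
by rewrite exprMn !sqr_l2norm rdot_adj hermsym_adj XXv rdotZr.
Qed.

Lemma opnorm0_spectrum (a : C) : c = 0 -> spectrum (absmx X) a -> a = 0.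
Proof.
move=> c0 /eigenvalueP[v vA v0].
have X0 (w : 'cV[C]_n) : X *m w = 0.
  apply/l2norm_eq0/eqP; rewrite eq_le l2norm_ge0 andbT.
  by rewrite (le_trans (l2norm_mulmx _ _))// c0 mul0r.
have XX0 : X^t* *m X = 0.
  rewrite -[LHS]mulmx1 -[RHS](mul0mx _ (1%:M : 'M[C]_n)).
  by apply: mulmx_colP => w; rewrite -mulmxA X0 mulmx0 mul0mx.
have : v *m (absmx X *m absmx X) = (a * a) *: v.
  by rewrite mulmxA vA -scalemxAl vA scalerA.
rewrite (absmxP X).2 XX0 mulmx0 => /esym/eqP; rewrite scaler_eq0 (negPf v0) orbF.
by rewrite mulf_eq0 orbb => /eqP.
Qed.

(** iX is anti-Hermitian, hence skew for the real inner product. *)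
Lemma rdot_iX (v : 'cV[C]_n) : rdot v ('i *: (X *m v)) = 0.
Proof.
have : rdot v ('i *: (X *m v)) = - rdot v ('i *: (X *m v)).
  rewrite -{1}[v in LHS]scale1r.
  have -> : rdot (1 *: v) ('i *: (X *m v)) = rdot (('i *: X)^t* *m v) v.
    by rewrite scale1r rdot_adj trmxCK -scalemxAl.
  rewrite rdotC adjmxZ hermsym_adj conjC_i.
  by rewrite -scalemxAl scaleNr rdotNr.
by move=> /eqP; rewrite -subr_eq0 opprK -mulr2n mulrn_eq0/= => /eqP.
Qed.

Lemma rdot_iXiX (v : 'cV[C]_n) : rdot ('i *: (X *m v)) ('i *: (X *m v)) =
  rdot v (X *m (X *m v)).
Proof.
have -> : rdot v (X *m (X *m v)) = rdot (X *m v) (X *m v).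
  by rewrite rdot_adj hermsym_adj.
rewrite !rdotE; apply: eq_bigr => i _.
by rewrite !mxE !reM !imM/=; ring.
Qed.

Lemma expmx_top p (B : 'M[C]_(n, p)) t : 0 < c -> X *m (X *m B) = (c ^+ 2)%:C *: B ->
  expmx (('i * t%:C) *: X) *m B =
  (cos (t * c))%:C *: B + (sin (t * c) / c)%:C *: ('i *: (X *m B)).
Proof.
move=> c0 XXB; rewrite (expmx_eigenspace t hX (lt0r_neq0 c0) XXB).
by congr (_ + _); rewrite [in RHS]scalerA; congr (_ *: _); exact: mulrC.
Qed.

Lemma expmx_top1 p (B : 'M[C]_(n, p)) : 0 < c -> X *m (X *m B) = (c ^+ 2)%:C *: B ->
  expmx ('i *: X) *m B = (cos c)%:C *: B + (sin c / c)%:C *: ('i *: (X *m B)).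
Proof.
move=> c0 XXB; have -> : 'i *: X = ('i * 1%:C) *: X by rewrite mulr1.
by rewrite (expmx_top 1 c0 XXB) mul1r.
Qed.

Lemma expmx_unitary t : expmx (('i * t%:C) *: X) \is unitarymx.
Proof. by rewrite expmx_spfun//; apply: spfun_unitary => x; exact: cis_unitary. Qed.

(** An eigenvalue x of X with |x| <= pi and e^{ix} = -1 satisfies |x| = pi, cosine being injective
    on [0, pi]. *)
Lemma expmxN1_ker (v : 'cV[C]_n) : c <= pi -> expmx ('i *: X) *m v = - v ->
  X *m (X *m v) = (pi ^+ 2)%:C *: v.
Proof.
move=> cpi; have -> : 'i *: X = ('i * 1%:C) *: X by rewrite mulr1.
rewrite (expmx_spfun _ hX) => Uv.
have /eq_spfunP h : spfun (fun x => cis (1 * x)) X *m v = spfun (fun=> -1) X *m v.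
  by rewrite Uv spfun_cst mul_scalar_mx scaleN1r.
rewrite {1 2}(hermsym_spfun hX) spfun_mul -mul_scalar_mx -(spfun_cst X).
apply/eq_spfunP => i k.
have := h i k; have [->|N0] := eqVneq ((spectralmx X *m v) i k) 0.
  by rewrite !mulr0.
move=> /(mulIf N0); rewrite mul1r => -[cosd _].
have : `|eigs X i| = pi.
  apply: (@cos_inj R); rewrite ?in_itv/= ?normr_ge0 ?pi_ge0 ?lexx//.
    by rewrite (le_trans (eigs_le i hX)).
  by rewrite cos_norm cosd cospi.
by move=> e; rewrite -e real_normK ?num_real// expr2 rmorphM.
Qed.

End Hermitian.

(** Replaces the condition on the spectrum by an algebraic one, which is what the exponential
    formula uses. *)
Lemma hermsym_spectrum_pm n (Y : 'M[C]_n) (k : R) : Y \is hermsymmx ->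
  spectrum Y `<=` [set k%:C; - k%:C] <-> Y *m Y = (k ^+ 2)%:C%:M.
Proof.
move=> hY; split=> [h|YY a /eigenvalueP[v vY v0]]; last first.
  have : v *m (Y *m Y) = (a * a) *: v by rewrite mulmxA vY -scalemxAl vY scalerA.
  rewrite YY mul_mx_scalar => /eqP; rewrite -subr_eq0 -scalerBl scaler_eq0 (negPf v0).
  rewrite orbF subr_eq0 expr2 rmorphM/= -!expr2 eq_sym eqf_sqr => /orP[]/eqP ->.
    by left.
  by right.
have -> : Y *m Y = Y *m (Y *m 1%:M) by rewrite mulmx1.
rewrite {1 2}(hermsym_spfun hY) spfun_mul -[RHS]mulmx1 -(spfun_cst Y).
apply/eq_spfunP => i j; rewrite mulmx1; congr (_ * _).
suff : [set k%:C; - k%:C] ((eigs Y i)%:C).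
  by move=> [->|->]; rewrite ?mulrNN -rmorphM/= expr2.
apply: h; apply/eigenvalueP; exists (row i (spectralmx Y)).
  rewrite {2}(hermsym_spfun hY) /spfun !mulmxA -row_mul spectralmx_unitary row1.
  rewrite -rowE row_diag_mx -scalemxAl; congr (_ *: _); first by rewrite mxE.
  by rewrite -rowE.
apply/eqP => r0; have : row i (spectralmx Y) *m (spectralmx Y)^t* = 0.
  by rewrite r0 mul0mx.
rewrite -row_mul spectralmx_unitary row1 => /matrixP/(_ 0 i)/eqP.
by rewrite !mxE !eqxx oner_eq0.
Qed.

End TopEigenspace.

(** * Block operators, and the distance from the identity to U *)

Section MinimalCurves.
Context {R : realType}.
Local Notation C := R[i].

Lemma block_opE n p q (B : 'M[C]_(n, p)) (B' : 'M[C]_(n, q)) D D' :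
  block_op B B' D D' = B *m D *m B^t* + B' *m D' *m B'^t*.
Proof.
rewrite /block_op mul_row_block !mulmx0 addr0 add0r.
by rewrite tr_row_mx map_col_mx mul_row_col.
Qed.

Lemma orthonormal_basis_proj n p (B : 'M[C]_(n, p)) S (v : 'cV[C]_n) :
  orthonormal_basis B S -> S v -> B *m (B^t* *m v) = v.
Proof. by move=> [B1 ->] [w _ <-]; rewrite [B^t* *m _]mulmxA B1 mul1mx. Qed.

Lemma orthonormal_basis_mem n p (B : 'M[C]_(n, p)) S w :
  orthonormal_basis B S -> S (B *m w).
Proof. by move=> [_ ->]; exists w. Qed.

(** v - B B^* v is orthogonal to S, hence fixed by the projection B' B'^* ; no dimension count is
    involved. *)
Lemma orthonormal_basis_complete n p q (B : 'M[C]_(n, p)) (B' : 'M[C]_(n, q)) S :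
  orthonormal_basis B S -> orthonormal_basis B' (orthocompl S) ->
  B^t* *m B' = 0 /\ B *m B^t* + B' *m B'^t* = 1%:M.
Proof.
move=> oB oB'; have [B1 SB] := oB; have [B'1 _] := oB'.
have BB' : B^t* *m B' = 0.
  rewrite -[RHS](mul0mx _ B'); apply: mulmx_colP => w.
  have h := orthonormal_basis_mem w oB'.
  rewrite mul0mx; apply/matrixP => i j; rewrite ord1 mxE.
  have /(h _)/matrixP/(_ 0 0) := orthonormal_basis_mem (delta_mx i 0) oB.
  rewrite !mxE -colE => {2}<-; apply: eq_bigr => k _.
  by rewrite !mxE.
have B'B : B'^t* *m B = 0 by rewrite -(trmxCK B) -adjmxM BB' adjmx0.
split=> //; rewrite -[LHS]mulmx1 -[RHS]mulmx1; apply: mulmx_colP => v.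
rewrite !mul1mx mulmxDl -!mulmxA.
have Su : orthocompl S (v - B *m (B^t* *m v)).
  rewrite SB => _ [w _ <-]; rewrite adjmxM -mulmxA mulmxBr.
  by rewrite [X in _ - X]mulmxA B1 mul1mx subrr mulmx0.
have := orthonormal_basis_proj oB' Su.
rewrite mulmxBr [B'^t* *m (B *m _)]mulmxA B'B mul0mx subr0 => ->.
by rewrite addrC subrK.
Qed.

Section Blocks.
Variables (n p q : nat) (B : 'M[C]_(n, p)) (B' : 'M[C]_(n, q)).
Hypotheses (B1 : B^t* *m B = 1%:M) (B'1 : B'^t* *m B' = 1%:M)
  (BB' : B^t* *m B' = 0) (BBD : B *m B^t* + B' *m B'^t* = 1%:M).

Lemma adjB'B : B'^t* *m B = 0.
Proof. by rewrite -(trmxCK B) -adjmxM BB' adjmx0. Qed.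

Lemma restrict_block_op D D' : restrict_op B' (block_op B B' D D') = D'.
Proof.
rewrite /restrict_op block_opE mulmxDr mulmxDl -!mulmxA.
rewrite BB' !mulmx0 add0r B'1 mulmx1.
by rewrite mulmxA B'1 mul1mx.
Qed.

Lemma block_op_unitary D D' : D \is unitarymx -> D' \is unitarymx ->
  block_op B B' D D' \is unitarymx.
Proof.
move=> /unitarymxP uD /unitarymxP uD'; apply/unitarymxP.
rewrite !block_opE adjmxD !adjmxM !trmxCK mulmxDl !mulmxDr -!mulmxA.
rewrite [B^t* *m (B *m _)]mulmxA B1 [B'^t* *m (B' *m _)]mulmxA B'1.
rewrite [B^t* *m (B' *m _)]mulmxA BB' [B'^t* *m (B *m _)]mulmxA adjB'B.
rewrite !mul0mx !mulmx0 addr0 add0r !mul1mx.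
by rewrite [D *m _]mulmxA uD [D' *m _]mulmxA uD' !mul1mx.
Qed.

(** E^* B^* W = (W B)^* W = B^* W^* W = B^* , then multiply by E. This is the invariance of the
    orthogonal complement. *)
Lemma unitary_adj_intertwine (W : 'M[C]_n) (E : 'M[C]_p) : W \is unitarymx ->
  E \is unitarymx -> W *m B = B *m E -> B^t* *m W = E *m B^t*.
Proof.
move=> uW /unitarymxP uE WB.
have WW : W^t* *m W = 1%:M by apply/mulmx1C/unitarymxP.
rewrite -[B^t* in RHS]mulmx1 -WW [B^t* *m (_ *m _)]mulmxA -adjmxM WB adjmxM.
by rewrite !mulmxA uE mul1mx.
Qed.

Lemma block_op_restrict (W : 'M[C]_n) (E : 'M[C]_p) : W \is unitarymx ->
  E \is unitarymx -> W *m B = B *m E ->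
  W = block_op B B' E (restrict_op B' W) /\ restrict_op B' W \is unitarymx.
Proof.
move=> uW uE WB; have BW := unitary_adj_intertwine uW uE WB.
have WB' : W *m B' = B' *m restrict_op B' W.
  rewrite -[LHS]mul1mx -BBD mulmxDl -!mulmxA [B^t* *m (W *m _)]mulmxA BW.
  by rewrite -mulmxA BB' !mulmx0 add0r /restrict_op !mulmxA.
split; first by rewrite block_opE -WB -WB' -!mulmxA -mulmxDr BBD mulmx1.
apply/unitarymxP/mulmx1C.
have WW : W^t* *m W = 1%:M by apply/mulmx1C/unitarymxP.
set V := restrict_op B' W in WB' *.
have -> : V^t* *m V = (B' *m V)^t* *m (B' *m V).
  by rewrite adjmxM -!mulmxA [B'^t* *m (B' *m _)]mulmxA B'1 mul1mx.
by rewrite -WB' adjmxM -mulmxA [W^t* *m (W *m _)]mulmxA WW mul1mx.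
Qed.

Lemma opnorm_restrict (D : 'M[C]_n) : opnorm (restrict_op B' D) <= opnorm D.
Proof.
have oB : opnorm (B'^t*) <= 1.
  apply: (le_trans (opnorm_adj _)); apply: opnorm_le => // v.
  by rewrite l2norm_isometry// mul1r.
apply: opnorm_le => [|v]; first exact: opnorm_ge0.
rewrite /restrict_op -!mulmxA (le_trans (l2norm_mulmx _ _))//.
rewrite (le_trans (ler_wpM2r (l2norm_ge0 _) oB))// mul1r.
by rewrite (le_trans (l2norm_mulmx _ _))// l2norm_isometry.
Qed.

Lemma rdot_blocks (v : 'cV[C]_n) :
  rdot (B^t* *m v) (B^t* *m v) + rdot (B'^t* *m v) (B'^t* *m v) = rdot v v.
Proof.
by rewrite !rdot_adj !trmxCK -rdotDr !mulmxA -mulmxDl BBD mul1mx.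
Qed.

(** D is k times an isometry. Pythagoras gives the upper bound, and any vector of the first block,
    nonzero since p > 0, attains it. *)
Lemma opnorm_block_op D D' k : 0 <= k ->
  (forall w, rdot (D *m w) (D *m w) = k ^+ 2 * rdot w w) -> opnorm D' <= k ->
  (0 < p)%N -> opnorm (block_op B B' D D') = k.
Proof.
move=> k0 hD hD' p0; apply/eqP; rewrite eq_le; apply/andP; split.
  apply: opnorm_le => // v.
  rewrite -(@ler_pXn2r _ 2) ?nnegrE ?mulr_ge0 ?l2norm_ge0//.
  rewrite exprMn !sqr_l2norm block_opE mulmxDl -!mulmxA.
  rewrite rdotDr !rdotDl ![rdot (B *m _) _]rdot_adj ![rdot (B' *m _) _]rdot_adj.
  rewrite ![_ *m (B *m _)]mulmxA ![_ *m (B' *m _)]mulmxA B1 B'1 BB' adjB'B.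
  rewrite !mul0mx !mul1mx hD -[in leRHS]rdot_blocks.
  have r0 m (x : 'cV[C]_m) : rdot x 0 = 0 by rewrite /rdot mulmx0 mxE.
  rewrite !r0 addr0 add0r mulrDr lerD2l -!sqr_l2norm -exprMn.
  rewrite ler_pXn2r ?nnegrE ?mulr_ge0 ?l2norm_ge0//.
  by rewrite (le_trans (l2norm_mulmx _ _))// ler_wpM2r ?l2norm_ge0.
pose w : 'cV[C]_p := delta_mx (Ordinal p0) 0.
have w1 : rdot w w = 1.
  rewrite rdotE (bigD1 (Ordinal p0))//= big1 => [|i /negPf ki].
    by rewrite mxE !eqxx/= mulr1 mulr0 !addr0.
  by rewrite mxE ki/= !mulr0 addr0.
apply: (opnorm_ge (v := B *m w)).
  apply/eqP => Bw0; have := rdot_isometry w w B1.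
  by rewrite Bw0 w1 /rdot mulmx0 mxE => /esym/eqP; rewrite oner_eq0.
rewrite block_opE mulmxDl -!mulmxA [B^t* *m _]mulmxA B1 [B'^t* *m _]mulmxA adjB'B.
rewrite mul0mx !mulmx0 addr0 mul1mx !(l2norm_isometry _ B1).
by rewrite -(@ler_pXn2r _ 2) ?nnegrE ?mulr_ge0 ?l2norm_ge0// exprMn !sqr_l2norm hD.
Qed.

End Blocks.

Section Involution.
Variables (p : nat) (Y : 'M[C]_p) (k : R).
Hypotheses (hY : Y \is hermsymmx) (k0 : 0 < k) (YY : Y *m Y = (k ^+ 2)%:C%:M).
(** J^2 = -1, so J plays the role of the imaginary unit in the formula for e^{itY}. *)
Let J := k^-1%:C *: ('i *: Y).

Lemma expmx_sqr t : expmx (('i * t%:C) *: Y) =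
  (cos (t * k))%:C *: 1%:M + (sin (t * k))%:C *: J.
Proof.
rewrite -[LHS]mulmx1 (expmx_eigenspace (c := k) t hY (lt0r_neq0 k0)); last first.
  by rewrite mulmx1 YY scalemx1.
rewrite mulmx1 /J !scalerA; congr (_ + _ *: _).
by rewrite rmorphM/= mulrC.
Qed.

Let dE t := (- (k * sin (t * k)))%:C *: 1%:M + (k * cos (t * k))%:C *: J.

Lemma crel_real (K : (R -> R) -> R -> Prop) f d : linear_rel K -> K f d ->
  crel K (fun s => (f s)%:C) d%:C.
Proof. by move=> lK Kf; split => //=; exact: linrel0. Qed.

Lemma mxderiv_expmx_sqr t :
  mxrel (has_deriv t) (fun s => expmx (('i * s%:C) *: Y)) (dE t).
Proof.
rewrite (_ : (fun s => _) = fun s => (cos (s * k))%:C *: 1%:M + (sin (s * k))%:C *: J).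
  have lK := linear_rel_has_deriv t.
  have D1 : is_derive t 1 (fun x : R => x * k) k.
    rewrite (_ : (fun x => _) = k \*: id); last by apply/funext => z; rewrite mulrC.
    by apply: is_derive_eq; exact: mulr1.
  apply: mxrelD => //; apply: mxrel_scale => //; apply: crel_real => //.
  - rewrite mulrC -mulNr; exact: (@is_derive1_comp _ cos (fun x : R => x * k)).
  - rewrite mulrC; exact: (@is_derive1_comp _ sin (fun x : R => x * k)).
by apply/funext => s; rewrite expmx_sqr.
Qed.

Lemma mxsmooth_expmx_sqr : mxsmooth (fun s => expmx (('i * s%:C) *: Y)).
Proof.
rewrite (_ : (fun s => _) = fun s => (cos (s * k))%:C *: 1%:M + (sin (s * k))%:C *: J).
  have lK := @linear_rel_smooth R.
  apply: (@mxrelD _ _ lK _ _ _ _ 0 0).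
  - rewrite -(scale0r (1%:M : 'M[C]_p)); apply: mxrel_scale => //.
    by apply: (crel_real (d := 0)) => //; exact: smooth_cos.
  - rewrite -(scale0r J); apply: mxrel_scale => //.
    by apply: (crel_real (d := 0)) => //; exact: smooth_sin.
by apply/funext => s; rewrite expmx_sqr.
Qed.

(** w and J w are orthogonal of equal norm, so the velocity of e^{itY} stretches every vector by
    k. *)
Lemma rdot_dE t w : rdot (dE t *m w) (dE t *m w) = k ^+ 2 * rdot w w.
Proof.
have Jw : J *m w = k^-1%:C *: ('i *: (Y *m w)) by rewrite /J -!scalemxAl.
have wJ : rdot w (J *m w) = 0 by rewrite Jw rdotZr (rdot_iX hY) mulr0.
have JJ : rdot (J *m w) (J *m w) = rdot w w.
  rewrite Jw rdotZr rdotZl (rdot_iXiX hY) mulmxA YY mul_scalar_mx rdotZr.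
  by rewrite [k ^+ 2]expr2 -[k * k * _]mulrA !mulKf// gt_eqF.
rewrite /dE; move: (J) wJ JJ {Jw} => J' wJ JJ.
rewrite mulmxDl -!scalemxAl mul1mx rdotDr !rdotDl !rdotZr !rdotZl JJ wJ.
rewrite [rdot (J' *m w) w]rdotC wJ !mulr0 addr0 add0r.
rewrite !mulrA -mulrDl; congr (_ * _).
have := cos2Dsin2 (t * k); set a := cos _; set b := sin _ => ab.
by rewrite -[RHS]mulr1 -ab; ring.
Qed.

End Involution.

Section JoiningCurves.
Variables (n : nat) (X U : 'M[C]_n).
Hypotheses (hX : X \is hermsymmx) (UE : U = expmx ('i *: X)).
Local Notation c := (opnorm X).
Hypotheses (c0 : 0 < c) (cpi : c <= pi) (n0 : (0 < n)%N).

Let top (v : 'cV[C]_n) := X *m (X *m v) = (c ^+ 2)%:C *: v.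

Lemma joining_unitary : U \is unitarymx.
Proof.
rewrite UE; have -> : 'i *: X = ('i * 1%:C) *: X by rewrite mulr1.
exact: expmx_unitary.
Qed.

Lemma rdot_top (v : 'cV[C]_n) : rdot v v = 1 -> top v -> rdot v (U *m v) = cos c.
Proof.
move=> v1 tv; rewrite UE (expmx_top1 hX c0 tv) rdotDr !rdotZr (rdot_iX hX) v1.
by rewrite mulr0 addr0 mulr1.
Qed.

Lemma opnorm_le_length g : curve_joining 1%:M U g -> c <= curve_length g.
Proof.
move=> [pg ug g0 g1]; rewrite leNgt; apply/negP => Lc.
have [v v1 tv] := top_eigenvector hX n0.
have L0 := curve_length_ge0 pg.
have Lpi := le_trans (ltW Lc) cpi.
have := cos_length_le_rdot pg ug v1 Lpi; rewrite g0 g1 mul1mx rdot_top//.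
by rewrite leNgt ltr_cos ?Lc// in_itv/= ?L0 ?Lpi ?opnorm_ge0 ?cpi.
Qed.

(** The one-parameter group shows that the lower bound c for lengths is attained. *)
Let geo t := expmx (('i * t%:C) *: X).

Lemma mxrel_geo K (d : R -> C) : linear_rel K ->
  (forall x : R, crel K (fun s => cis (s * x)) (d x)) -> mxrel K geo (spfun d X).
Proof.
move=> lK h; rewrite (_ : geo = fun s => spfun (fun x => cis (s * x)) X).
  move=> j k; rewrite spfunE.
  rewrite (_ : (fun s => _) = fun s => \sum_l
      ((spectralmx X l j)^* * spectralmx X l k) * cis (s * eigs X l)).
    by apply: crel_sum => // l; exact: crelZ.
  by apply/funext => s; rewrite spfunE.
by apply/funext => s; rewrite /geo expmx_spfun.
Qed.

Lemma geo_joining : curve_joining 1%:M U geo.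
Proof.
split.
- apply: mxsmooth_piecewise_smooth.
  apply: (mxrel_geo (d := fun=> 0) (@linear_rel_smooth R)) => x.
  by split; [exact: smooth_cos|exact: smooth_sin].
- by move=> t _; exact: expmx_unitary.
- rewrite /geo expmx_spfun// (_ : (fun x => _) = fun=> 1) ?spfun_cst//.
  by apply/funext => x; rewrite /cis mul0r cos0 sin0.
- by rewrite /geo mulr1 UE.
Qed.

Lemma geo_length : curve_length geo <= c.
Proof.
have [pg _ _ _] := geo_joining.
apply: (curve_length_le pg) => t _ _.
have /mxderP[_ D] : mxrel (has_deriv t) geo (spfun (fun x => (x%:C * ('i * cis (t * x)))) X).
  apply: mxrel_geo => [|x]; first exact: linear_rel_has_deriv.
  have D1 : is_derive t 1 (fun s : R => s * x) x.
    rewrite (_ : (fun x => _) = x \*: id); last by apply/funext => z; rewrite mulrC.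
    by apply: is_derive_eq; exact: mulr1.
  split.
  - apply: (is_derive_eq (f' := - sin (t * x) * x)).
      exact: (@is_derive1_comp _ cos (fun s : R => s * x)).
    by rewrite ?(reM, imM)/=; ring.
  - apply: (is_derive_eq (f' := cos (t * x) * x)).
      exact: (@is_derive1_comp _ sin (fun s : R => s * x)).
    by rewrite ?(reM, imM)/=; ring.
rewrite /speed D; apply: opnorm_spfun => [|i]; first exact: opnorm_ge0.
rewrite !Normc.normcM normc_real (_ : Normc.normc 'i = 1); last first.
  by rewrite /Normc.normc expr0n add0r expr1n sqrtr1.
rewrite (_ : Normc.normc _ = 1) ?mulr1 ?eigs_le//.
by rewrite /Normc.normc/= cos2Dsin2 sqrtr1.
Qed.

Lemma dinf_joining : dinf 1%:M U = c.
Proof.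
have geoM : [set curve_length g | g in [set g | curve_joining 1%:M U g]] (curve_length geo).
  exact: (ex_intro2 _ _ geo geo_joining erefl).
apply/eqP; rewrite eq_le; apply/andP; split.
  apply: le_trans geo_length; apply: ge_inf => //.
  by exists c => _ [g gJ <-]; exact: opnorm_le_length.
apply: lb_le_inf; first by exists (curve_length geo).
by move=> _ [g gJ <-]; exact: opnorm_le_length.
Qed.

(** The constant value of the speed equals the length, hence the distance c. *)
Lemma minimal_curve_speed g : minimal_curve 1%:M U g ->
  forall t, 0 < t < 1 -> mxderivable g t -> speed g t = c.
Proof.
move=> [[pg _ _ _] Lg [k gk]] t t01 gt.
by rewrite gk// -dinf_joining -Lg (curve_length_cst pg gk).
Qed.

Lemma minimal_curve_of_speed g : curve_joining 1%:M U g ->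
  (forall t, 0 < t < 1 -> mxderivable g t -> speed g t = c) ->
  minimal_curve 1%:M U g.
Proof.
move=> gJ gc; have [pg _ _ _] := gJ; split=> //; last by exists c.
by rewrite dinf_joining; exact: curve_length_cst.
Qed.

End JoiningCurves.
End MinimalCurves.

(** * Reduction to blocks, and rigidity for angles below pi *)

Section Characterization.
Context {R : realType}.
Local Notation C := R[i].
Variables (n : nat) (X U : 'M[C]_n).
Hypotheses (hX : X \is hermsymmx) (UE : U = expmx ('i *: X)).
Local Notation c := (opnorm X).
Hypotheses (c0 : 0 < c) (cpi : c <= pi) (n0 : (0 < n)%N).

Let S : set 'cV[C]_n := [set v | X *m (X *m v) = (c ^+ 2)%:C *: v].

Variables (p q : nat) (B : 'M[C]_(n, p)) (B' : 'M[C]_(n, q)).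
Hypotheses (oB : orthonormal_basis B S) (oB' : orthonormal_basis B' (orthocompl S)).

Let B1 : B^t* *m B = 1%:M. Proof. by have [] := oB. Qed.
Let B'1 : B'^t* *m B' = 1%:M. Proof. by have [] := oB'. Qed.
Let BB' : B^t* *m B' = 0. Proof. by have [] := orthonormal_basis_complete oB oB'. Qed.
Let BBD : B *m B^t* + B' *m B'^t* = 1%:M.
Proof. by have [] := orthonormal_basis_complete oB oB'. Qed.
Let uU : U \is unitarymx := joining_unitary hX UE.

Lemma top_basis : X *m (X *m B) = (c ^+ 2)%:C *: B.
Proof.
rewrite mulmxA -mul_scalar_mx; apply: mulmx_colP => w.
by rewrite mul_scalar_mx -mulmxA (orthonormal_basis_mem w oB).
Qed.

Lemma top_basis_gt0 : (0 < p)%N.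
Proof.
rewrite lt0n; apply/eqP => p0; have [v v1 Sv] := top_eigenvector hX n0.
have : S v by [].
have [_ ->] := oB => -[w _ wv]; have := oner_neq0 R.
rewrite -v1 -wv rdot_isometry// rdotE big1 ?eqxx// => -[m mp] _; exfalso.
by rewrite p0 in mp.
Qed.

Lemma top_factor r (Q : 'M[C]_(n, r)) :
  X *m (X *m Q) = (c ^+ 2)%:C *: Q -> Q = B *m (B^t* *m Q).
Proof.
move=> XXQ; rewrite mulmxA -[LHS]mul1mx; apply: mulmx_colP => w.
rewrite mul1mx -mulmxA (orthonormal_basis_proj oB)// /S/=.
by rewrite !mulmxA -(mulmxA X X Q) XXQ scalemxAl.
Qed.

Section Reduction.
Variable Y : 'M[C]_p.
Hypotheses (hY : Y \is hermsymmx) (YY : Y *m Y = (c ^+ 2)%:C%:M).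
Let E t := expmx (('i * t%:C) *: Y).
Let uE t : E t \is unitarymx := expmx_unitary hY t.

Lemma minimal_curve_block g : minimal_curve 1%:M U g ->
  (forall t, 0 <= t <= 1 -> g t *m B = B *m E t) ->
  exists g1 : R -> 'M[C]_q,
    [/\ curve_joining 1%:M (restrict_op B' U) g1, speed_bounded g1 c &
        forall t, 0 <= t <= 1 -> g t = block_op B B' (E t) (g1 t)].
Proof.
move=> mg gB; have [[pg ug g0 g1] _ _] := mg.
have gE t : 0 <= t <= 1 -> g t = block_op B B' (E t) (restrict_op B' (g t)) /\
    restrict_op B' (g t) \is unitarymx.
  by move=> t01; exact: (block_op_restrict B'1 BB' BBD (ug t t01) (uE t) (gB t t01)).
exists (fun t => restrict_op B' (g t)); split.
- split=> [|t t01||].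
  + apply: (@piecewise_smooth_map _ _ _ (fun=> restrict_op B') g) => // h sh.
    apply: (@mxrel_mulr _ _ (@linear_rel_smooth R) _ _ _ B' _ (B'^t* *m 0)).
    exact: (@mxrel_mull _ _ (@linear_rel_smooth R) _ _ _ (B'^t*) _ 0).
  + by have [] := gE t t01.
  + by rewrite g0 /restrict_op mulmx1.
  + by rewrite g1.
- move=> t t01 dg1; have lK := linear_rel_has_deriv t.
  have /mxderP D1 := conj dg1 (erefl (mxderive (fun t => restrict_op B' (g t)) t)).
  have DE := mxderiv_expmx_sqr hY c0 YY t.
  (* The speed of g is known only where g is derivable, so derivability of g at t is first recovered
     from that of its two blocks. *)
  have Db := mxrelD lK (mxrel_mulr lK (B^t*) (mxrel_mull lK B DE))
                       (mxrel_mulr lK (B'^t*) (mxrel_mull lK B' D1)).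
  have tI : t \in `]0, 1[ by rewrite in_itv.
  have gn : \forall s \near t, B *m E s *m B^t* + B' *m restrict_op B' (g s) *m B'^t* = g s.
    apply: filterS (near_in_itvoo tI) => s.
    rewrite in_itv/= => /andP[/ltW s0 /ltW s1].
    by rewrite -block_opE; have [<-] := gE s (introT andP (conj s0 s1)).
  have /mxderP[dg _] := mxder_near gn Db.
  have /mxderP Dg := conj dg (erefl (mxderive g t)).
  have /mxderP[_ D1E] := mxrel_mulr lK B' (mxrel_mull lK (B'^t*) Dg).
  rewrite -(minimal_curve_speed hX UE c0 cpi n0 mg t01 dg).
  by rewrite /speed [mxderive _ t]D1E; exact: opnorm_restrict.
- by move=> t t01; have [] := gE t t01.
Qed.

Lemma block_minimal_curve g (g1 : R -> 'M[C]_q) : U *m B = B *m E 1 ->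
  curve_joining 1%:M (restrict_op B' U) g1 -> speed_bounded g1 c ->
  (forall t, 0 <= t <= 1 -> g t = block_op B B' (E t) (g1 t)) ->
  minimal_curve 1%:M U g.
Proof.
move=> UB [pg1 ug1 g10 g11] sg1 gE.
(* g is prescribed on [0, 1] only; b is the same block formula on the whole line, where smoothness
   of each piece can be checked. *)
pose b t := block_op B B' (E t) (g1 t).
have E0 : E 0 = 1%:M.
  by rewrite /E (expmx_sqr hY c0 YY) mul0r cos0 sin0 scale0r addr0 scale1r.
apply: (minimal_curve_of_speed hX UE c0 cpi n0); first split.
- apply: (@eq_piecewise_smooth _ _ b) => [t t01|]; first by rewrite gE.
  apply: (@piecewise_smooth_map _ _ _ (fun s h => block_op B B' (E s) h) g1) => // h sh.
  have lK := @linear_rel_smooth R.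
  rewrite (_ : (fun s => _) =
      fun s => B *m E s *m B^t* + B' *m h s *m B'^t*); last first.
    by apply/funext => s; rewrite block_opE.
  have sE : mxrel (fun f _ => smooth f) E 0 by exact: (mxsmooth_expmx_sqr hY c0 YY).
  have sh' : mxrel (fun f _ => smooth f) h 0 by exact: sh.
  exact: (mxrelD lK (mxrel_mulr lK (B^t*) (mxrel_mull lK B sE))
                    (mxrel_mulr lK (B'^t*) (mxrel_mull lK B' sh'))).
- by move=> t t01; rewrite (gE t t01); exact: (block_op_unitary B1 B'1 BB' BBD (uE t) (ug1 t t01)).
- by rewrite gE ?lexx ?ler01// g10 E0 block_opE !mulmx1 BBD.
- rewrite gE ?lexx ?ler01// g11.
  by have [<- _] := block_op_restrict B'1 BB' BBD uU (uE 1) UB.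
move=> t t01 dg; have lK := linear_rel_has_deriv t.
have tI : t \in `]0, 1[ by rewrite in_itv.
have /mxderP Dg := conj dg (erefl (mxderive g t)).
(* Compressing g gives derivability of g1 at t, so the speed bound on g1 applies there. *)
have D1 : mxrel (has_deriv t) g1 (restrict_op B' (mxderive g t)).
  apply: mxder_near (mxrel_mulr lK B' (mxrel_mull lK (B'^t*) Dg)).
  apply: filterS (near_in_itvoo tI) => s; rewrite in_itv/= => /andP[/ltW s0 /ltW s1].
  by rewrite gE ?s0// -[LHS]/(restrict_op B' _) restrict_block_op.
have /mxderP[dg1 D1E] := D1.
have DE := mxderiv_expmx_sqr hY c0 YY t.
have Db := mxrelD lK (mxrel_mulr lK (B^t*) (mxrel_mull lK B DE))
                     (mxrel_mulr lK (B'^t*) (mxrel_mull lK B' D1)).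
have gn : \forall s \near t, B *m E s *m B^t* + B' *m g1 s *m B'^t* = g s.
  apply: filterS (near_in_itvoo tI) => s; rewrite in_itv/= => /andP[/ltW s0 /ltW s1].
  by rewrite gE ?s0// block_opE.
have /mxderP[_ DgE] := mxder_near gn Db.
rewrite /speed DgE -block_opE; apply: opnorm_block_op => //.
- exact: opnorm_ge0.
- by move=> w; exact: (rdot_dE hY c0 YY).
- by have := sg1 t t01 dg1; rewrite /speed D1E.
- exact: top_basis_gt0.
Qed.

End Reduction.

Section MinimalCurve.
Variable g : R -> 'M[C]_n.
Hypothesis mg : minimal_curve 1%:M U g.

Lemma minimal_curve_rdot_ge (v : 'cV[C]_n) s t : rdot v v = 1 ->
  0 <= s -> s <= t -> t <= 1 -> cos (c * (t - s)) <= rdot (g s *m v) (g t *m v).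
Proof.
have [[pg ug _ _] _ _] := mg => v1 s0 st t1.
apply: (cos_speed_le_rdot pg ug v1 _ s0 st t1) => [r r01 gr|].
  by rewrite (minimal_curve_speed hX UE c0 cpi n0 mg).
apply: le_trans cpi; rewrite ler_piMr ?opnorm_ge0//.
by rewrite lerBlDr (le_trans t1)// lerDl.
Qed.

(* With v = g 0 v and U v = g 1 v at angle c < pi, the geodesic of the sphere
   from v to U v is sin c y(t) = sin (c (1 - t)) v + sin (c t) U v, and
   <v, g t v> >= cos (c t), <U v, g t v> >= cos (c (1 - t)) force
   <y(t), g t v> >= 1. *)
Lemma minimal_curve_top (v : 'cV[C]_n) t : c < pi -> rdot v v = 1 -> S v ->
  0 <= t <= 1 -> g t *m v = expmx (('i * t%:C) *: X) *m v.
Proof.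
move=> cltpi v1 Sv /andP[t0 t1]; have [[pg ug g0 g1] _ _] := mg.
have t01 : 0 <= t <= 1 by rewrite t0.
set x := g t *m v; set y := _ *m v; symmetry; apply: eq_unit_rdot.
- by rewrite (rdot_unitary _ _ (expmx_unitary hX t)).
- by rewrite (rdot_unitary _ _ (ug t t01)).
have h0 := minimal_curve_rdot_ge v1 (lexx 0) t0 t1.
have h1 := minimal_curve_rdot_ge v1 t0 t1 (lexx 1).
rewrite g0 mul1mx subr0 -/x in h0; rewrite g1 -/x rdotC UE (expmx_top1 hX c0 Sv) in h1.
rewrite /y (expmx_top hX t c0 Sv) !rdotDl !rdotZl.
rewrite !rdotDl !rdotZl in h1.
set a := rdot v x in h0 h1 *; set b := rdot _ x in h1 *.
have sc : 0 < sin c by rewrite sin_gt0_pi// c0.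
have st : 0 <= sin (t * c).
  rewrite sin_ge0_pi// mulr_ge0 ?opnorm_ge0//= (le_trans _ cpi)//.
  by rewrite ler_piMl ?opnorm_ge0.
have sct : 0 <= sin (c - t * c).
  rewrite sin_ge0_pi// subr_ge0 ler_piMl ?opnorm_ge0//= (le_trans _ cpi)//.
  by rewrite lerBlDr lerDl mulr_ge0 ?opnorm_ge0.
rewrite mulrC in h0; rewrite mulrBr mulr1 [c * t]mulrC in h1.
have sE : sin c = sin (c - t * c) * cos (t * c) + cos (c - t * c) * sin (t * c).
  by rewrite -sinD subrK.
have sE' : sin (c - t * c) = sin c * cos (t * c) - cos c * sin (t * c) by rewrite sinB.
rewrite -(ler_pM2l sc) mulr1.
have -> : sin c * (cos (t * c) * a + sin (t * c) / c * b) =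
    a * sin (c - t * c) + sin (t * c) * (cos c * a + sin c / c * b).
  by rewrite sE'; ring.
rewrite {1}sE lerD//; first by rewrite mulrC ler_wpM2r.
by rewrite mulrC ler_wpM2l.
Qed.

End MinimalCurve.

End Characterization.

(** * Half great circles and the antipodal case *)

Section HalfTurns.
Context {R : realType}.
Local Notation C := R[i].

Lemma cos_pi4 : [/\ cos (pi / 4) = sin (pi / 4) :> R, 0 < cos (pi / 4 : R) &
  cos (pi / 4) ^+ 2 = 2^-1 :> R].
Proof.
have e : cos (pi / 4) = sin (pi / 4) :> R.
  rewrite -cosBpihalf -cosN; congr cos; by field.
split=> //; first by apply: cos_gt0_pihalf; have := @pi_gt0 R; lra.
have := cos2Dsin2 (pi / 4 : R); rewrite -e; lra.
Qed.

(** The angle bounds from v and from - v squeeze <v, g t v> to cos(t pi), so w = g (1/2) v is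
    orthogonal to v. The bound from w gives <w, g t v> >= sin(t pi), and a unit vector with these
    components along v and w is the stated one. *)
Lemma great_circle n (g : R -> 'M[C]_n) (v : 'cV[C]_n) :
  piecewise_smooth g -> (forall t, 0 <= t <= 1 -> g t \is unitarymx) ->
  (forall t, 0 < t < 1 -> mxderivable g t -> speed g t <= pi) ->
  rdot v v = 1 -> g 0 *m v = v -> g 1 *m v = - v ->
  rdot v (g 2^-1 *m v) = 0 /\
  forall t, 0 <= t <= 1 ->
    g t *m v = (cos (t * pi))%:C *: v + (sin (t * pi))%:C *: (g 2^-1 *m v).
Proof.
move=> pg ug gk v1 g0 g1.
have H s t : 0 <= s -> s <= t -> t <= 1 ->
    cos (pi * (t - s)) <= rdot (g s *m v) (g t *m v).
  move=> s0 st t1; apply: cos_speed_le_rdot => //.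
  by rewrite ler_piMr ?pi_ge0// lerBlDr (le_trans t1)// lerDl.
have rv t : 0 <= t <= 1 -> rdot v (g t *m v) = cos (t * pi).
  move=> /andP[t0 t1]; have h0 := H 0 t (lexx _) t0 t1.
  have h1 := H t 1 t0 t1 (lexx _).
  rewrite g0 subr0 mulrC in h0.
  rewrite g1 rdotNr rdotC mulrBr mulr1 cosB cospi sinpi mul0r addr0 mulN1r in h1.
  rewrite mulrC in h1; apply/eqP; rewrite eq_le h0 andbT.
  by rewrite lerN2 in h1.
have half : 0 <= (2^-1 : R) <= 1 by apply/andP; split; lra.
have w0 : rdot v (g 2^-1 *m v) = 0 by rewrite rv// mulrC cos_pihalf.
split=> // t t01; set w := g 2^-1 *m v in w0 *.
have w1 : rdot w w = 1 by rewrite (rdot_unitary _ _ (ug _ half)).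
have hw : sin (t * pi) <= rdot w (g t *m v).
  case/andP: t01 => t0 t1; have [t2|/ltW t2] := leP t 2^-1.
    have := H t 2^-1 t0 t2 (andP half).2; rewrite rdotC; apply: le_trans.
    by rewrite -cosBpihalf -cosN le_eqVlt; apply/orP; left; apply/eqP; congr cos; field.
  have := H 2^-1 t (andP half).1 t2 t1; apply: le_trans.
  by rewrite -cosBpihalf le_eqVlt; apply/orP; left; apply/eqP; congr cos; field.
have s0 : 0 <= sin (t * pi).
  by case/andP: t01 => t0 t1; rewrite sin_ge0_pi// mulr_ge0 ?pi_ge0//= ler_piMl ?pi_ge0.
have cs := cos2Dsin2 (t * pi).
symmetry; apply: eq_unit_rdot.
- rewrite rdotDr !rdotDl !rdotZr !rdotZl v1 w1 [rdot w v]rdotC w0.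
  by rewrite !mulr1 !mulr0 addr0 add0r -!expr2 cs.
- by rewrite (rdot_unitary _ _ (ug t t01)).
- rewrite rdotDl !rdotZl rv// -cs -expr2 lerD2l expr2.
  exact: ler_wpM2l.
Qed.

Lemma speed_adj n (g : R -> 'M[C]_n) t : mxderivable (fun s => (g s)^t*) t ->
  mxderivable g t /\ speed (fun s => (g s)^t*) t <= speed g t.
Proof.
move=> dh; have lK := linear_rel_has_deriv t.
have /mxderP/(mxrel_adj lK) := conj dh (erefl (mxderive (fun s => (g s)^t*) t)).
rewrite (_ : (fun s => _) = g) => [/mxderP[dg]|]; last first.
  by apply/funext => s; rewrite trmxCK.
rewrite /speed => ->; split; first exact: dg.
by have := opnorm_adj ((mxderive (fun s => (g s)^t*) t)^t*); rewrite trmxCK.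
Qed.

Lemma piecewise_smooth_adj n (g : R -> 'M[C]_n) : piecewise_smooth g ->
  piecewise_smooth (fun s => (g s)^t*).
Proof.
apply: (@piecewise_smooth_map _ _ _ (fun=> fun A : 'M[C]_n => A^t*)) => h sh.
exact: (@mxrel_adj _ _ (@linear_rel_smooth R) _ _ _ 0).
Qed.

(* Both g and its adjoint move v along half great circles, which pass through
   w = g (1/2) v and w' = g (1/2)^* v. Expressing (g t)^* w through v and w', the
   angle bounds for the adjoint curve give w' = - w at t = 1/4, and U^* w = - w
   at t = 3/4. *)
Lemma half_turn n (g : R -> 'M[C]_n) (U : 'M[C]_n) (v : 'cV[C]_n) :
  curve_joining 1%:M U g ->
  (forall t, 0 < t < 1 -> mxderivable g t -> speed g t <= pi) ->
  rdot v v = 1 -> U *m v = - v ->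
  [/\ (g 2^-1)^t* *m v = - (g 2^-1 *m v),
      U *m (g 2^-1 *m v) = - (g 2^-1 *m v) &
      forall t, 0 <= t <= 1 ->
        g t *m v = (cos (t * pi))%:C *: v + (sin (t * pi))%:C *: (g 2^-1 *m v)].
Proof.
have n4 : 0 <= (4^-1 : R) <= 1 by apply/andP; split; lra.
have n34 : 0 <= (3 / 4 : R) <= 1 by apply/andP; split; lra.
have half : 0 <= (2^-1 : R) <= 1 by apply/andP; split; lra.
have q4 : 4^-1 * pi = pi / 4 :> R by rewrite mulrC.
have q34 : 3 / 4 * pi = pi - pi / 4 :> R by field.
have q14 : pi * (1 - 3 / 4) = pi / 4 :> R by field.
move=> [pg ug g0 g1] gk v1 Uv.
have uU : U \is unitarymx by rewrite -g1 ug// lexx ler01.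
have UU : U^t* *m U = 1%:M by apply/mulmx1C/unitarymxP.
have Uav : U^t* *m v = - v by rewrite -[v in LHS]opprK -Uv mulmxN mulmxA UU mul1mx.
have ph := piecewise_smooth_adj pg.
have uh t : 0 <= t <= 1 -> (g t)^t* \is unitarymx by move=> t01; rewrite trmxC_unitary ug.
have hk t : 0 < t < 1 -> mxderivable (fun s => (g s)^t*) t ->
    speed (fun s => (g s)^t*) t <= pi.
  by move=> t01 /speed_adj[dg l]; apply: (le_trans l); exact: gk.
have gv0 : g 0 *m v = v by rewrite g0 mul1mx.
have gv1 : g 1 *m v = - v by rewrite g1.
have hv0 : (g 0)^t* *m v = v by rewrite g0 adjmx1 mul1mx.
have hv1 : (g 1)^t* *m v = - v by rewrite g1.
have [w0 gt] := great_circle pg ug gk v1 gv0 gv1.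
have [w'0 ht] := great_circle ph uh hk v1 hv0 hv1.
set w := g 2^-1 *m v in w0 gt *.
set w' := (g 2^-1)^t* *m v in w'0 ht *.
have w1 : rdot w w = 1 by rewrite (rdot_unitary _ _ (ug _ half)).
have w'1 : rdot w' w' = 1 by rewrite (rdot_unitary _ _ (uh _ half)).
have key t : 0 <= t <= 1 ->
    (sin (t * pi))%:C *: ((g t)^t* *m w) =
    v - (cos (t * pi))%:C *: ((cos (t * pi))%:C *: v + (sin (t * pi))%:C *: w').
  move=> t01; rewrite -ht//; apply/eqP; rewrite eq_sym subr_eq addrC; apply/eqP.
  rewrite 2!scalemxAr -mulmxDr -gt// mulmxA (_ : _ *m g t = 1%:M) ?mul1mx//.
  by apply/mulmx1C/unitarymxP; exact: ug.
have bound s t : 0 <= s -> s <= t -> t <= 1 ->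
    cos (pi * (t - s)) <= rdot ((g s)^t* *m w) ((g t)^t* *m w).
  move=> s0 st t1; apply: (cos_speed_le_rdot ph) => //.
  by rewrite ler_piMr ?pi_ge0// lerBlDr (le_trans t1)// lerDl.
have [r1 r0 r2] := cos_pi4; set r := cos (pi / 4) in r1 r0 r2.
have w'E : w' = - w.
  symmetry; apply: eq_unit_rdot => //; first by rewrite rdotNl rdotNr opprK.
  have := bound 0 4^-1 (lexx _); rewrite g0 adjmx1 mul1mx subr0 => b.
  have {}b : r <= rdot w ((g 4^-1)^t* *m w) := b (andP n4).1 (andP n4).2.
  have := congr1 (rdot w) (key 4^-1 n4); rewrite rdotZr rdotDr rdotNr rdotZr rdotDr !rdotZr.
  rewrite q4 -r1 -/r [rdot w v]rdotC w0 mulr0 add0r => k.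
  rewrite rdotNl -(ler_pM2l r0) -(ler_pM2l r0) mulr1 !mulrN.
  have : r * r <= r * rdot w ((g 4^-1)^t* *m w) by rewrite ler_pM2l.
  by rewrite k add0r.
split=> //.
have uUa : U^t* \is unitarymx by rewrite trmxC_unitary.
have wU : w = - (U^t* *m w).
  apply: eq_unit_rdot => //.
    by rewrite rdotNl rdotNr opprK (rdot_unitary _ _ uUa).
  have := bound (3 / 4) 1 (andP n34).1 (andP n34).2 (lexx _).
  rewrite g1 q14 -/r => b.
  have := congr1 (fun x : 'cV[C]_n => rdot x (U^t* *m w)) (key (3 / 4) n34).
  rewrite /= rdotZl rdotDl rdotNl rdotZl rdotDl !rdotZl w'E rdotNl.
  have -> : rdot v (U^t* *m w) = 0 by rewrite -rdot_adj Uv rdotNl w0 oppr0.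
  rewrite q34 sinB cosB cospi sinpi !mul0r !sub0r addr0 mulN1r opprK -r1 -/r => k.
  rewrite rdotNr -(ler_pM2l r0) -(ler_pM2l r0) mulr1.
  have : r * r <= r * rdot ((g (3 / 4))^t* *m w) (U^t* *m w) by rewrite ler_pM2l.
  rewrite k => /le_trans; apply; rewrite le_eqVlt; apply/orP; left; apply/eqP; ring.
by rewrite {1}wU mulmxN mulmxA (unitarymxP uU) mul1mx.
Qed.

End HalfTurns.

(** * The two cases and the theorem *)

Lemma spectrum_gt0_dim (R : realType) n (A : 'M[R[i]]_n) a : spectrum A a -> (0 < n)%N.
Proof.
move=> /eigenvalueP[v _ v0]; rewrite lt0n; apply: contraNneq v0 => n0.
by apply/eqP/rowP => -[m mn]; exfalso; rewrite n0 in mn.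
Qed.

(** S is invariant under X, with restriction Y satisfying Y^2 = c^2; then e^{itX} B = B e^{itY}
    turns rigidity on vectors of S into the intertwining that the block reduction takes as input. *)
Lemma minimal_curve_small_angleP (R : realType) n (U X : 'M[R[i]]_n) p q
    (B : 'M[R[i]]_(n, p)) (B' : 'M[R[i]]_(n, q)) (g : R -> 'M[R[i]]_n) :
  X \is hermsymmx -> U = expmx ('i *: X) -> (0 < n)%N ->
  0 < opnorm X -> opnorm X < pi ->
  orthonormal_basis B [set v | X *m (X *m v) = (opnorm X ^+ 2)%:C *: v] ->
  orthonormal_basis B'
    (orthocompl [set v | X *m (X *m v) = (opnorm X ^+ 2)%:C *: v]) ->
  minimal_curve 1%:M U g <->
  exists g1 : R -> 'M[R[i]]_q,
    [/\ curve_joining 1%:M (restrict_op B' U) g1, speed_bounded g1 (opnorm X) &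
        forall t, 0 <= t <= 1 -> g t =
          block_op B B' (expmx (('i * t%:C) *: restrict_op B X)) (g1 t)].
Proof.
move=> hX hUX n0 c0 cpi oB oB'; have hXpi := ltW cpi.
have [B1 _] := oB; have XXB := top_basis oB.
pose Y := restrict_op B X.
have XB : X *m B = B *m Y.
  rewrite /Y /restrict_op -!mulmxA; apply: (top_factor oB).
  by rewrite XXB -scalemxAr.
have hY : Y \is hermsymmx.
  by rewrite hermsymmxE /Y /restrict_op !adjmxM trmxCK (hermsym_adj hX) mulmxA.
have YY : Y *m Y = (opnorm X ^+ 2)%:C%:M.
  rewrite {1}/Y /restrict_op -!mulmxA -XB XXB -scalemxAr B1.
  by rewrite scalemx1.
have geoB t : expmx (('i * t%:C) *: X) *m B = B *m expmx (('i * t%:C) *: Y).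
  rewrite (expmx_top hX t c0 XXB) (expmx_sqr hY c0 YY) mulmxDr -!scalemxAr mulmx1.
  by rewrite XB scalerA rmorphM.
split=> [mg|[g1 [Jg1 sg1 gE]]].
  apply: (minimal_curve_block hX hUX c0 hXpi n0 oB oB' hY YY mg) => t t01.
  rewrite -geoB; apply: (mulmx_unitP B1) => w w1.
  apply: (minimal_curve_top hX hUX c0 hXpi n0 mg) => //.
  exact: (orthonormal_basis_mem w oB).
apply: (block_minimal_curve hX hUX c0 hXpi n0 oB oB' hY YY _ Jg1 sg1 gE).
by rewrite -geoB mulr1 -hUX.
Qed.

Lemma minimal_curve_antipodalP (R : realType) n (U X : 'M[R[i]]_n) p q
    (B : 'M[R[i]]_(n, p)) (B' : 'M[R[i]]_(n, q)) (g : R -> 'M[R[i]]_n) :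
  X \is hermsymmx -> U = expmx ('i *: X) -> (0 < n)%N -> opnorm X = pi ->
  orthonormal_basis B [set v | X *m (X *m v) = (opnorm X ^+ 2)%:C *: v] ->
  orthonormal_basis B'
    (orthocompl [set v | X *m (X *m v) = (opnorm X ^+ 2)%:C *: v]) ->
  minimal_curve 1%:M U g <->
  exists (Y : 'M[R[i]]_p) (g1 : R -> 'M[R[i]]_q),
    [/\ Y \is hermsymmx, spectrum Y `<=` [set pi%:C; - pi%:C],
        curve_joining 1%:M (restrict_op B' U) g1, speed_bounded g1 pi &
        forall t, 0 <= t <= 1 -> g t =
          block_op B B' (expmx (('i * t%:C) *: Y)) (g1 t)].
Proof.
move=> hX hUX n0 cE oB oB'; have pi0 := @pi_gt0 R.
have c0 : 0 < opnorm X by rewrite cE.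
have hXpi : opnorm X <= pi by rewrite cE.
have [B1 _] := oB; have XXB := top_basis oB.
have UB : U *m B = - B.
  rewrite hUX (expmx_top1 hX c0 XXB) cE cospi sinpi mul0r scale0r addr0.
  by rewrite rmorphN scaleN1r.
split=> [mg|[Y [g1 [hY sY Jg1 sg1 gE]]]]; last first.
  have YY : Y *m Y = (opnorm X ^+ 2)%:C%:M by rewrite cE; apply/hermsym_spectrum_pm.
  rewrite -cE in sg1.
  apply: (block_minimal_curve hX hUX c0 hXpi n0 oB oB' hY YY _ Jg1 sg1 gE).
  rewrite (expmx_sqr hY c0 YY) mul1r cE cospi sinpi scale0r addr0 UB.
  by rewrite rmorphN scaleN1r mulmxN mulmx1.
have [Jg _ _] := mg; have [pg ug g0 g1] := Jg.
pose W := g 2^-1.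
have uW : W \is unitarymx by apply: ug; apply/andP; split; lra.
have sg t : 0 < t < 1 -> mxderivable g t -> speed g t <= pi.
  by move=> t01 gt; rewrite -cE (minimal_curve_speed hX hUX c0 hXpi n0 mg).
have turn w : rdot (B *m w) (B *m w) = 1 ->
    [/\ W^t* *m (B *m w) = - (W *m (B *m w)),
        U *m (W *m (B *m w)) = - (W *m (B *m w)) &
        forall t, 0 <= t <= 1 -> g t *m (B *m w) =
          (cos (t * pi))%:C *: (B *m w) + (sin (t * pi))%:C *: (W *m (B *m w))].
  by move=> w1; apply: (half_turn Jg sg w1); rewrite mulmxA UB mulNmx.
have WB : W^t* *m B = - W *m B.
  by apply: (mulmx_unitP B1) => w /turn[-> _ _]; rewrite mulNmx.
have UWB : U *m W *m B = - W *m B.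
  by apply: (mulmx_unitP B1) => w /turn[_ e _]; rewrite -mulmxA e mulNmx.
have gB t : 0 <= t <= 1 ->
    g t *m B = ((cos (t * pi))%:C%:M + (sin (t * pi))%:C *: W) *m B.
  move=> t01; apply: (mulmx_unitP B1) => w /turn[_ _ ->] //.
  by rewrite mulmxDl mul_scalar_mx -scalemxAl.
pose Z := restrict_op B W.
(* W maps S into S: U acts as -1 on W S, and the norm of X is at most pi. *)
have XXWB : X *m (X *m (W *m B)) = (opnorm X ^+ 2)%:C *: (W *m B).
  rewrite mulmxA -mul_scalar_mx [LHS]mulmxA [RHS]mulmxA; apply: mulmx_colP => w.
  rewrite -!mulmxA mul_scalar_mx cE; apply: (expmxN1_ker hX) => //.
  by rewrite -hUX !mulmxA UWB !mulNmx.
have WBZ : W *m B = B *m Z.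
  by rewrite /Z /restrict_op -!mulmxA; exact: (top_factor oB).
have ZC : Z^t* = - Z.
  rewrite /Z /restrict_op !adjmxM trmxCK WB mulNmx mulmxN mulmxA.
  by [].
have ZZ : Z *m Z = - 1%:M.
  have WW : W *m (W *m B) = - B.
    rewrite -[W *m B]opprK -mulNmx -WB mulmxN mulmxA.
    by rewrite (unitarymxP uW) mul1mx.
  by rewrite {1}/Z /restrict_op -!mulmxA -WBZ WW mulmxN B1.
(* Chosen so that iY / pi = Z, that is e^{iY/2} = Z; Y is Hermitian because Z is anti-Hermitian, and
   Y^2 = pi^2 because Z^2 = -1. *)
pose Y := (- ('i * pi%:C)) *: Z.
have hY : Y \is hermsymmx.
  rewrite hermsymmxE /Y adjmxZ ZC rmorphN rmorphM/= conjC_i conjC_real.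
  by rewrite mulNr opprK scalerN scaleNr.
have YY : Y *m Y = (opnorm X ^+ 2)%:C%:M.
  rewrite /Y -scalemxAl -scalemxAr scalerA ZZ scalerN mulrNN mulrACA -expr2 sqr_i.
  by rewrite mulN1r scaleNr opprK -rmorphM -expr2 cE scalemx1.
have gBE t : 0 <= t <= 1 -> g t *m B = B *m expmx (('i * t%:C) *: Y).
  move=> t01; rewrite gB// (expmx_sqr hY c0 YY) cE mulmxDl mul_scalar_mx mulmxDr.
  rewrite -!scalemxAr mulmx1 -scalemxAl WBZ; congr (_ + _ *: _).
  rewrite !scalerA -[LHS]scale1r; congr (_ *: _); rewrite -mulrA.
  have -> : ('i : R[i]) * - ('i * pi%:C) = pi%:C.
    by rewrite mulrN mulrA -expr2 sqr_i mulN1r opprK.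
  by rewrite -rmorphM mulVf// gt_eqF.
have [g1' [J s E]] := minimal_curve_block hX hUX c0 hXpi n0 oB oB' hY YY mg gBE.
exists Y, g1'; split=> //; last by rewrite cE in s.
by apply/hermsym_spectrum_pm; rewrite // -cE.
Qed.

Theorem theorem2p1 (R : realType) (n : nat) (U X : 'M[R[i]]_n)
    (hU : U \is unitarymx) (hX : X \is hermsymmx)
    (hUX : U = expmx ('i *: X)) (hXpi : opnorm X <= pi) :
  (spectrum (absmx X) `<=` [set a | 0 <= a < pi%:C] ->
   (exists a b, [/\ spectrum (absmx X) a, spectrum (absmx X) b & a != b]) ->
   let S := kerset ((opnorm X)%:C%:M - absmx X) in
   forall (p q : nat) (B : 'M[R[i]]_(n, p)) (B' : 'M[R[i]]_(n, q)),
     orthonormal_basis B S -> orthonormal_basis B' (orthocompl S) ->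
     forall alpha : R -> 'M[R[i]]_n,
       minimal_curve 1%:M U alpha <->
       exists alpha1 : R -> 'M[R[i]]_q,
         [/\ curve_joining 1%:M (restrict_op B' U) alpha1,
             speed_bounded alpha1 (opnorm X) &
             forall t, 0 <= t <= 1 ->
               alpha t = block_op B B'
                 (expmx (('i * t%:C) *: restrict_op B X)) (alpha1 t)])
  /\
  (spectrum (absmx X) pi%:C ->
   let S := kerset (pi%:C%:M - absmx X) in
   forall (p q : nat) (B : 'M[R[i]]_(n, p)) (B' : 'M[R[i]]_(n, q)),
     orthonormal_basis B S -> orthonormal_basis B' (orthocompl S) ->
     forall alpha : R -> 'M[R[i]]_n,
       minimal_curve 1%:M U alpha <->
       exists (Y : 'M[R[i]]_p) (alpha1 : R -> 'M[R[i]]_q),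
         [/\ Y \is hermsymmx,
             spectrum Y `<=` [set pi%:C; - pi%:C],
             curve_joining 1%:M (restrict_op B' U) alpha1,
             speed_bounded alpha1 pi &
             forall t, 0 <= t <= 1 ->
               alpha t = block_op B B'
                 (expmx (('i * t%:C) *: Y)) (alpha1 t)]).
Proof.
split=> [specX [a [b [sa sb ab]]] S p q B B' oB oB' g|specX S p q B B' oB oB' g].
- have n0 := spectrum_gt0_dim sa.
  (* If c = 0, then 0 is the only eigenvalue of |X|, against the two distinct ones a and b. *)
  have c0 : 0 < opnorm X.
    rewrite lt_def opnorm_ge0 andbT; apply: contra_neq ab => c0.
    by rewrite (opnorm0_spectrum c0 sa) (opnorm0_spectrum c0 sb).
  (* c is itself an eigenvalue of |X|, so the bound on the spectrum applies to it. *)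
  have cpi : opnorm X < pi.
    have [v v1 Xv] := top_eigenvector hX n0.
    have v0 : v != 0.
      apply/eqP => v0; move: v1; rewrite v0 /rdot mulmx0 mxE => /esym/eqP.
      by rewrite oner_eq0.
    have : spectrum (absmx X) (opnorm X)%:C by apply/(spectrum_absmxP hX c0); exists v.
    by move=> /specX/= /andP[_]; rewrite ltcR.
  rewrite {}/S (kerset_absmx hX c0) in oB oB'.
  exact: minimal_curve_small_angleP.
- have n0 := spectrum_gt0_dim specX.
  have pi0 := @pi_gt0 R.
  have [v v0 Xv] := (spectrum_absmxP hX pi0).1 specX.
  have cE : opnorm X = pi.
    by apply/eqP; rewrite eq_le hXpi (opnorm_ge_sqr_eigenvalue hX v0 (ltW pi0) Xv).
  have c0 : 0 < opnorm X by rewrite cE.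
  rewrite {}/S -cE (kerset_absmx hX c0) in oB oB'.
  exact: (minimal_curve_antipodalP _ hX hUX n0 cE oB oB').
Qed.
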